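(* Adopt the setting of the context and fix a compact set $K\subset\overline\Omega$. Let $\varepsilon_k\downarrow0$, $h_k\downarrow0$, $L_k\to\infty$, $n_k\to\infty$, with $N$, $M_p$ and $\delta\in(0,M_p]$ fixed. For each $k$ let $\pi_{k,0},\dots,\pi_{k,n_k}\in\Pi_{L_k}$ (the localized class at mesh $h_k$), let $v_{\theta_{k,0}},\dots,v_{\theta_{k,n_k}}:\mathbb R^d\to\mathbb R$ be bounded Borel functions (neural evaluations), and write $w_{k,j}=S_{\varepsilon_k,h_k}(\pi_{k,j})$, $\xi^{\rm val}_{k,j}=\|v_{\theta_{k,j}}-w_{k,j}\|_{\infty,Q_{L_k}}$, with $v^*_{L_k}$ taken at $(\varepsilon_k,h_k)$. Assume that for each sufficiently large $k$ there is $D_{L_k}>0$ with $$\{y\in Q_{L_k}:\mathrm{dist}(y,\mathbb R^d\setminus Q_{L_k})\le D_{L_k}+h_k\}\subset\{\mathrm{dist}(\cdot,\overline\Omega)\ge\delta\},\qquad \mathrm{dist}(K,\mathbb R^d\setminus Q_{L_k})>D_{L_k}+h_k .$$ Suppose also that: (R1) $h_k\le\min\{h_0,\varepsilon_k\}$ and $\lambda h_k\le2dN$; (R2) $D_{L_k}\ge\frac{4dN}{\lambda}\log\Bigl(\frac{24\,C_{\rm ext}}{\delta h_k^2}\Bigr)$, where $C_{\rm ext}=\frac{2\sqrt d\,M_b(\|f\|_\infty+M_p)}{\lambda}+2\|f\|_\infty$; (R3) $\gamma_{h_k}^{\,n_k}\,\|w_{k,0}-v^*_{L_k}\|_{\infty,\mathbb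 R^d}\to0$; (R4) $h_k^{-2}\sup_{0\le j\le n_k}\xi^{\rm val}_{k,j}\to0$ and $h_k^{-1}\sup_{0\le j<n_k}\ \sup_{Q_{L_k}^{h_k}}\Gamma_{\varepsilon_k,h_k}(v_{\theta_{k,j}},\pi_{k,j+1})\to0$; (R5) $\|u-u^{\varepsilon_k}\|_{\infty,K}\to0$ and $\|u^{\varepsilon_k}-v_{\varepsilon_k,h_k}\|_{\infty,K}\to0$. Then $$\|u-v_{\theta_{k,n_k}}\|_{L^\infty(K)}\to0\qquad\text{and}\qquad\|u-v_{\theta_{k,n_k}}\|_{L^2(K)}\to0 .$$ Moreover, $\gamma_{h_k}^{\,n_k}/\varepsilon_k\to0$ is sufficient for (R3).
   Context: Setting. $|\cdot|$ is the Euclidean norm; $\|z\|_{\infty,D}=\|z\|_{L^\infty(D)}=\sup_D|z|$ is the pointwise supremum, $\|\cdot\|_\infty$ the supremum over the full domain; $L^2$ is with respect to Lebesgue measure. $\Omega\subset\mathbb R^d$ is a bounded domain with $C^2$ boundary and outward unit normal $n$; $A\subset\mathbb R^m$ is compact; $\lambda>0$; $b:\mathbb R^d\times A\to\mathbb R^d$ and $f:\mathbb R^d\times A\to[0,\infty)$ are continuous, bounded, and Lipschitz in $x$ uniformly in $a$, with $\mathrm{Lip}_x(b)<\lambda$; $M_b:=\sup|b|$. There is $\nu>0$ such that for each $x\in\partial\Omega$ some $a\in A$ satisfies $b(x,a)\cdot n(x)\le-\nu$. The Hamiltonian $H(x,p)=\sup_{a\in A}\{-b(x,a)\cdot p-f(x,a)\}$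 tends to $\infty$ as $|p|\to\infty$ uniformly in $x\in\overline\Omega$. For a fixed $M_p>0$, $p_\Omega(x)=\min\{\mathrm{dist}(x,\overline\Omega),M_p\}$. $N>0$ is fixed with $N\ge\frac12\sup_{x,a}\max_i|b_i(x,a)|$; $h,\varepsilon>0$. Continuous values. For measurable $\alpha:[0,\infty)\to A$, $X^{x,\alpha}$ solves $\dot X=b(X,\alpha)$, $X(0)=x$. $u(x)=\inf\int_0^\infty e^{-\lambda t}f(X^{x,\alpha},\alpha)\,dt$ over $\alpha$ with $X^{x,\alpha}(t)\in\overline\Omega$ for all $t\ge0$ ($x\in\overline\Omega$); $u^\varepsilon(x)=\inf_\alpha\int_0^\infty e^{-\lambda t}\bigl(f(X^{x,\alpha},\alpha)+\frac1\varepsilon p_\Omega(X^{x,\alpha})\bigr)dt$ over all measurable controls. Scheme. $(\nabla_hv)_i(x)=\frac{v(x+he_i)-v(x-he_i)}{2h}$, $\Delta_hv(x)=\sum_{i=1}^d\frac{v(x+he_i)-2v(x)+v(x-he_i)}{h^2}$, $\nu_h=Nh$, $\gamma_h=\frac{2dN}{\lambda h+2dN}$. A policy is a Borel map $\pi:\mathbb R^d\to A$. Set $c_\pi=f(\cdot,\pi)+p_\Omega/\varepsilon$, $\mathcal L^\pi_{\varepsilon,h}v=\lambda v-b(\cdot,\pi)\cdot\nabla_hv-\nu_h\Delta_hv-c_\pi$, $\mathcal F_{\varepsilon,h}[v]=\lambda v+H(x,\nabla_hv)-\nu_h\Delta_hv-p_\Omega/\varepsilon$, $\Gamma_{\varepsilon,h}(v,\pi)=\mathcal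 F_{\varepsilon,h}[v]-\mathcal L^\pi_{\varepsilon,h}v\ge0$. $S_{\varepsilon,h}(\pi)$ and $v_{\varepsilon,h}$ are the unique bounded Borel zeros of $\mathcal L^\pi_{\varepsilon,h}$ and $\mathcal F_{\varepsilon,h}$ on $\mathbb R^d$. Inward feedback. Constants $r_1\in(0,1]$, $\nu_0\in(0,1]$, $C_\Omega\ge1$, a function $\tilde d\in C^{1,1}(\mathbb R^d)$ and a Borel feedback $\bar\pi:\mathbb R^d\to A$ are fixed (they exist) such that: (V1) $|\nabla\tilde d|\le1$ and $\|D^2\tilde d\|_{L^\infty}\le C_\Omega$; (V2) $\tilde d\le0$ on $\overline\Omega$ and $\tilde d(x)\ge\frac12\min\{\mathrm{dist}(x,\overline\Omega),r_1\}$ for $x\notin\overline\Omega$; (V3) $b(x,\bar\pi(x))\cdot\nabla\tilde d(x)\le-\nu_0$ whenever $|\tilde d(x)|\le r_1$. Leakage constants. $C_*\ge1$ (depending only on $\lambda,\nu_0,d,N,M_b,C_\Omega$) and $h_0\in(0,1]$ (depending additionally on $M_p,r_1$) are constants, which exist, such that $S_{\varepsilon,h}(\bar\pi)\le\|f\|_\infty/\lambda+C_*h/\varepsilon$ on $\overline\Omega$ for all $h\in(0,h_0]$, $\varepsilon>0$. Localized class. $0<h<L$; $Q_L=[-L,L]^d$ contains $\overline\Omega$ in its interior; $Q_L^h=[-L+h,L-h]^d$. $\Pi_L$ is the set of Borel policies equal to $\bar\pi$ on $\mathbb R^d\setminus Q_L^h$; $v_L^*(x)=\inf_{\pi\in\Pi_L}S_{\varepsilon,h}(\pi)(x)$.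 *)

(* Defs.v *)
From HB Require Import structures.
From mathcomp Require Import all_boot all_order all_algebra.
From mathcomp Require Import all_classical all_reals all_analysis.
Import Order.TTheory GRing.Theory Num.Theory numFieldNormedType.Exports.

Set Implicit Arguments.
Unset Strict Implicit.
Unset Printing Implicit Defensive.

Local Open Scope classical_set_scope.
Local Open Scope ring_scope.

(* R^d is ['rV[R]_d].  Its library norm [`|x|] is the maximum norm, which
   gives the right topology; every metric notion below is Euclidean. *)
Section Euclidean.
Context {R : realType}.

Definition dot d (x y : 'rV[R]_d) : R := \sum_(i < d) x 0 i * y 0 i.

Definition enorm d (x : 'rV[R]_d) : R := Num.sqrt (dot x x).

Definition basis d (i : 'I_d) : 'rV[R]_d := delta_mx 0 i.

(* [dist] is meaningful for nonempty S; [setdist] is +oo when S or T is empty. *)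
Definition dist d (x : 'rV[R]_d) (S : set 'rV[R]_d) : R :=
  inf [set enorm (x - y) | y in S].

Definition setdist d (S T : set 'rV[R]_d) : \bar R :=
  ereal_inf [set (enorm (y - z))%:E | y in S & z in T].

Definition cube d (r : R) : set 'rV[R]_d :=
  [set x | forall i, - r <= x 0 i <= r].

(* Pointwise supremum of |z| over D; the added 0 only matters when D is empty. *)
Definition supnorm T (D : set T) (z : T -> \bar R) : \bar R :=
  ereal_sup ([set 0%E] `|` [set `|z x|%E | x in D]).

(* Best Lipschitz constant in x, uniformly in a \in A. *)
Definition lipx d m (W : zmodType) (nrm : W -> R) (A : set 'rV[R]_m)
    (g : 'rV[R]_d -> 'rV[R]_m -> W) : \bar R :=
  ereal_sup [set l | exists x y a, [/\ x != y, A a &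
    l = (nrm (g x a - g y a) / enorm (x - y))%:E]].

End Euclidean.

Notation Borel T := (g_sigma_algebraType (@open T)).

(* The outer measure is the infimum of the total volumes of countable covers
   by closed boxes.  [mu_ext] takes its infimum over covers by Borel sets, and
   [box_volume] is +oo on a nonempty set that is not a box.  The measure is the
   restriction to the Caratheodory (that is, Lebesgue) sigma-algebra. *)
Section Lebesgue.
Context {R : realType} {d : nat}.
Notation V := 'rV[R]_d.

Definition box (a b : V) : set V := [set x | forall i, a 0 i <= x 0 i <= b 0 i].

Definition box_volume (E : set (Borel V)) : \bar R :=
  ereal_inf ([set v | E = set0 /\ v = 0%E] `|`
    [set v | exists a b : V, [/\ forall i, a 0 i <= b 0 i, E = box a b &
      v = (\prod_(i < d) (b 0 i - a 0 i))%:E]]).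

Lemma box_volume_ge0 E : (0 <= box_volume E)%E.
Proof.
apply: le_ereal_inf_tmp => _ [[_ ->]//|[a [b [ab _ ->]]]].
by rewrite lee_fin; apply: prodr_ge0 => i _; rewrite subr_ge0.
Qed.

Lemma box_volume0 : box_volume set0 = 0%E.
Proof.
apply/eqP; rewrite eq_le box_volume_ge0 andbT.
by apply: ereal_inf_lbound; left.
Qed.

Definition lebesgue_outer : set (Borel V) -> \bar R := mu_ext box_volume.

HB.instance Definition _ := isOuterMeasure.Build R (Borel V) lebesgue_outer
  (mu_ext0 box_volume0 box_volume_ge0) (mu_ext_ge0 box_volume_ge0)
  (@le_mu_ext _ _ _ box_volume) (mu_ext_sigma_subadditive box_volume_ge0).

Definition lebesgue_rV : set (caratheodory_type lebesgue_outer) -> \bar R :=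
  lebesgue_outer.

HB.instance Definition _ := isMeasure.Build _ _ _ lebesgue_rV
  (@caratheodory_measure0 R (Borel V) lebesgue_outer)
  (@caratheodory_measure_ge0 R (Borel V) lebesgue_outer)
  (@caratheodory_measure_sigma_additive R (Borel V) lebesgue_outer).

End Lebesgue.
Arguments lebesgue_rV : clear implicits.

Section Calculus.
Context {R : realType} {d : nat}.
Notation V := 'rV[R]_d.

Definition partial (i : 'I_d) (g : V -> R) (x : V) : R := 'D_(basis i) g x.

Definition grad (g : V -> R) (x : V) : V := \row_i partial i g x.

Definition hess (g : V -> R) (x : V) : 'M[R]_d :=
  \matrix_(i, j) partial j (partial i g) x.

Definition C1_on (U : set V) (g : V -> R) : Prop :=
  forall i, (forall x, U x -> derivable g x (basis i)) /\
            (forall x, U x -> {for x, continuous (partial i g)}).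

Definition C2_on (U : set V) (g : V -> R) : Prop :=
  C1_on U g /\ forall i, C1_on U (partial i g).

Definition C11 (g : V -> R) : Prop :=
  C1_on setT g /\
  exists M : R, forall x y, enorm (grad g x - grad g y) <= M * enorm (x - y).

(* The L^infty norm of D^2 g, with the operator norm of matrices, is <= C. *)
Definition hess_Linfty_le (g : V -> R) (C : R) : Prop :=
  {ae lebesgue_rV R d, forall x : V,
    forall v : V, enorm (v *m hess g x) <= C * enorm v}.

(* Near its point x, Omega is the sublevel set {rho < 0} of a C^2 submersion;
   the boundary is then {rho = 0} on U, and rho(x) = 0 if x is a boundary
   point. *)
Definition C2_defining (Omega : set V) (x : V) (U : set V) (rho : V -> R) :=
  [/\ open U, U x, C2_on U rho, (forall y, U y -> grad rho y != 0) &
      (forall y, U y -> (Omega y <-> rho y < 0))].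

Definition bdry (Omega : set V) : set V := closure Omega `\` interior Omega.

Definition C2_boundary (Omega : set V) : Prop :=
  forall x, bdry Omega x -> exists U rho, C2_defining Omega x U rho.

Definition outward_unit_normal (Omega : set V) (x n : V) : Prop :=
  exists U rho, C2_defining Omega x U rho /\
    n = (enorm (grad rho x))^-1 *: grad rho x.

End Calculus.

Record model (R : realType) (d m : nat) := Model {
  Omega : set 'rV[R]_d;
  ctrls : set 'rV[R]_m;
  lambda : R;
  drift : 'rV[R]_d -> 'rV[R]_m -> 'rV[R]_d;
  cost : 'rV[R]_d -> 'rV[R]_m -> R;
  Mp : R;
  Nv : R
}.

Section Model.
Context {R : realType} {d m : nat}.
Notation V := 'rV[R]_d.
Notation W := 'rV[R]_m.
Variable P : model R d m.
Local Notation A := (ctrls P).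
Local Notation b := (drift P).
Local Notation f := (cost P).
Local Notation lam := (lambda P).

Definition Mb : R := sup [set enorm (b x a) | x in setT & a in A].

Definition fnorm : R := sup [set `|f x a| | x in setT & a in A].

Definition Cext : R :=
  2 * Num.sqrt d%:R * Mb * (fnorm + Mp P) / lam + 2 * fnorm.

Definition ham (x p : V) : R := sup [set - dot (b x a) p - f x a | a in A].

Definition pen (x : V) : R := Num.min (dist x (closure (Omega P))) (Mp P).

Record standing : Prop := Standing {
  dim_gt0 : (0 < d)%N;
  Omega_domain : [/\ open (Omega P), connected (Omega P),
                     bounded_set (Omega P) & Omega P !=set0];
  Omega_C2 : C2_boundary (Omega P);
  ctrls_compact : compact A;
  lambda_gt0 : 0 < lam;
  drift_continuous :
    {within [set z : V * W | A z.2], continuous (fun z => b z.1 z.2)};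
  cost_continuous :
    {within [set z : V * W | A z.2], continuous (fun z => f z.1 z.2)};
  drift_bounded : exists M, forall x a, A a -> enorm (b x a) <= M;
  cost_bounded : exists M, forall x a, A a -> f x a <= M;
  cost_ge0 : forall x a, A a -> 0 <= f x a;
  drift_lip : (lipx (@enorm R d) A b < lam%:E)%E;
  cost_lip : (lipx Num.norm A f < +oo)%E;
  inward : exists2 nu : R, 0 < nu & forall x n, bdry (Omega P) x ->
    outward_unit_normal (Omega P) x n -> exists2 a, A a & dot (b x a) n <= - nu;
  coercive : forall M : R, exists r : R, forall x p,
    closure (Omega P) x -> r <= enorm p -> M <= ham x p;
  Mp_gt0 : 0 < Mp P;
  Nv_gt0 : 0 < Nv P;
  Nv_large : 2^-1 * sup [set \big[Num.max/0]_(i < d) `|b x a 0 i|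
                        | x in setT & a in A] <= Nv P
}.

(* The line with its Lebesgue sigma-algebra, carried by R. *)
Definition line := caratheodory_type ((wlength (@idfun R))^*)%mu.
Local Notation leb := (@completed_lebesgue_measure R).

(* Controls and trajectories are only looked at on [0, +oo[. *)
Definition control (alpha : R -> W) : Prop :=
  measurable_fun (`[0, +oo[ : set line) (alpha : line -> Borel W) /\
  forall t, 0 <= t -> A (alpha t).

(* Caratheodory solution of X' = b(X, alpha), X(0) = x. *)
Definition trajectory (x : V) (alpha : R -> W) (X : R -> V) : Prop :=
  {within `[0, +oo[, continuous X} /\
  forall t, 0 <= t -> forall i,
    X t 0 i = x 0 i + \int[leb]_(s in `[0, t]) b (X s) (alpha s) 0 i.

Definition discounted (l : R -> R) : \bar R :=
  (\int[leb]_(t in `[0%R, +oo[) (expR (- (lam * t)) * l t)%:E)%E.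

Definition u_constrained (x : V) : \bar R :=
  ereal_inf [set J | exists alpha X, [/\ control alpha, trajectory x alpha X,
    forall t, 0 <= t -> closure (Omega P) (X t) &
    J = discounted (fun t => f (X t) (alpha t))]].

Definition u_penalized (eps : R) (x : V) : \bar R :=
  ereal_inf [set J | exists alpha X, [/\ control alpha, trajectory x alpha X &
    J = discounted (fun t => f (X t) (alpha t) + eps^-1 * pen (X t))]].

Definition grad_h (h : R) (v : V -> R) (x : V) : V :=
  \row_i ((v (x + h *: basis i) - v (x - h *: basis i)) / (2 * h)).

Definition lap_h (h : R) (v : V -> R) (x : V) : R :=
  \sum_(i < d) (v (x + h *: basis i) - 2 * v x + v (x - h *: basis i)) / h ^+ 2.

Definition nu_h (h : R) : R := Nv P * h.

Definition gamma_h (h : R) : R :=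
  (2 * d%:R * Nv P) / (lam * h + 2 * d%:R * Nv P).

Definition policy (pi : V -> W) : Prop :=
  measurable_fun [set: Borel V] (pi : Borel V -> Borel W) /\
  forall x, A (pi x).

Definition bounded_borel (v : V -> R) : Prop :=
  (exists M, forall x, `|v x| <= M) /\
  measurable_fun [set: Borel V] (v : Borel V -> R).

Definition L_op (eps h : R) (pi : V -> W) (v : V -> R) (x : V) : R :=
  lam * v x - dot (b x (pi x)) (grad_h h v x) - nu_h h * lap_h h v x
  - (f x (pi x) + pen x / eps).

Definition F_op (eps h : R) (v : V -> R) (x : V) : R :=
  lam * v x + ham x (grad_h h v x) - nu_h h * lap_h h v x - pen x / eps.

Definition Gamma (eps h : R) (v : V -> R) (pi : V -> W) (x : V) : R :=
  F_op eps h v x - L_op eps h pi v x.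

(* S_{eps,h}(pi) and v_{eps,h}: for eps, h > 0 and a policy pi, each of the two
   sets has exactly one element, and [get] returns it. *)
Definition policy_value (eps h : R) (pi : V -> W) : V -> R :=
  get [set v : V -> R | bounded_borel v /\ forall x, L_op eps h pi v x = 0].

Definition v_scheme (eps h : R) : V -> R :=
  get [set v : V -> R | bounded_borel v /\ forall x, F_op eps h v x = 0].

Record inward_feedback (r1 nu0 COmega : R) (dt : V -> R) (pibar : V -> W) :
    Prop := InwardFeedback {
  r1_range : 0 < r1 <= 1;
  nu0_range : 0 < nu0 <= 1;
  COmega_ge1 : 1 <= COmega;
  dt_C11 : C11 dt;
  pibar_policy : policy pibar;
  dt_grad : forall x, enorm (grad dt x) <= 1;
  dt_hess : hess_Linfty_le dt COmega;
  dt_inside : forall x, closure (Omega P) x -> dt x <= 0;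
  dt_outside : forall x, ~ closure (Omega P) x ->
    2^-1 * Num.min (dist x (closure (Omega P))) r1 <= dt x;
  pibar_inward : forall x, `|dt x| <= r1 ->
    dot (b x (pibar x)) (grad dt x) <= - nu0
}.

Record leakage (pibar : V -> W) (Cstar h0 : R) : Prop := Leakage {
  Cstar_ge1 : 1 <= Cstar;
  h0_range : 0 < h0 <= 1;
  leakage_bound : forall eps h, 0 < h <= h0 -> 0 < eps ->
    forall x, closure (Omega P) x ->
      policy_value eps h pibar x <= fnorm / lam + Cstar * h / eps
}.

Definition localized (pibar : V -> W) (h L : R) : set (V -> W) :=
  [set pi | policy pi /\ forall x, ~ cube (L - h) x -> pi x = pibar x].

Definition v_star (pibar : V -> W) (eps h L : R) (x : V) : R :=
  inf [set policy_value eps h pi x | pi in localized pibar h L].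

End Model.

Definition L2norm (R : realType) (d : nat) (K : set 'rV[R]_d)
    (z : 'rV[R]_d -> \bar R) : \bar R :=
  ('N[lebesgue_rV R d]_2%:E[z \_ K])%E.

(* Main.v *)
Require Import Defs.
From mathcomp Require Import all_boot all_order all_algebra.
From mathcomp Require Import all_classical all_reals all_analysis.
From mathcomp Require Import measurable_realfun ring lra.
Import Order.TTheory GRing.Theory Num.Theory numFieldNormedType.Exports.

(* Solving the scheme at [x] for [v x] turns it into a monotone Bellman map that
   contracts the supremum norm with factor gamma_h: [v x] is gamma_h times a
   convex combination of the values of [v] at the neighbours [x +- h e_i], plus
   a cost.
   - An eta-greedy Borel policy for v_{eps,h}, set to pibar outside Q_L^h, has a
     value exceeding v_{eps,h} by at most gamma_h^j |f + p/eps|_oo / lambda plus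
     O(eta) at points that are j mesh steps away from the boundary of Q_L.  By
     (R2) the factor gamma_h^j is O(h^2), which beats 1/eps because h <= eps.
     Hence v*_L - v_{eps,h} -> 0 on K.
   - A step of policy iteration whose evaluation error is xi and whose greedy
     residual is g contracts the distance to v*_L by gamma_h, up to an error
     beta / (1 - gamma_h) with beta = 2 gamma_h xi + O(h g); summing up gives
     beta / (1 - gamma_h)^2 = O(xi / h^2 + g / h).
   No optimal localized policy is needed: v*_L is only ever compared with the
   values of individual policies. *)

Set Implicit Arguments.
Unset Strict Implicit.
Unset Printing Implicit Defensive.

Local Open Scope classical_set_scope.
Local Open Scope ring_scope.

Local Notation basis := Defs.basis.

(** * Contractions in the supremum norm *)

Section Contraction.
Context {R : realType} {T : Type}.

(** The supremum [s] of [z] satisfies [s <= q * s + beta], and boundedness allows solving for [s].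
    This one-sided form drives the later comparisons between two solutions. *)
Lemma contraction_ub (z : T -> R) (q beta : R) : 0 <= q < 1 ->
  (exists B, forall x, z x <= B) ->
  (forall M, (forall y, z y <= M) -> forall x, z x <= q * M + beta) ->
  forall x, z x <= beta / (1 - q).
Proof.
move=> /andP[q0 q1] [B zB] zq x.
have ubz : has_ubound (range z) by exists B => _ [y _ <-].
have zS y : z y <= sup (range z) by apply: ub_le_sup => //; exists y.
have : sup (range z) <= q * sup (range z) + beta.
  by apply: ge_sup; [exists (z x), x | move=> _ [y _ <-]; exact: zq].
rewrite ler_pdivlMr ?subr_gt0// => Sq.
apply: (@le_trans _ _ (sup (range z) * (1 - q))); last by lra.
by rewrite ler_wpM2r// subr_ge0 ltW.
Qed.

(** Banach iteration from 0 with geometrically decaying increments. The pointwise convergence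
    belongs to the conclusion because it later makes the fixed point Borel. *)
Lemma contraction_fixpoint (F : (T -> R) -> T -> R) (q C : R) :
  0 <= q < 1 -> 0 <= C ->
  (forall v w (M : R) x, (forall y, `|v y - w y| <= M) ->
    `|F v x - F w x| <= q * M) ->
  (forall x, `|F (cst 0) x| <= C) ->
  exists v : T -> R, [/\ forall x, `|v x| <= C / (1 - q), forall x, F v x = v x
    & forall x, iter n F (cst 0) x @[n --> \oo] --> v x].
Proof.
move=> /andP[q0 q1] C0 FC F0.
pose u n := iter n F (cst 0); pose K := C / (1 - q).
have KC : C = K * (1 - q) by rewrite /K divfK// subr_eq0 gt_eqF.
have qn0 n : 0 <= q ^+ n by rewrite exprn_ge0.
have u1 n x : `|u n.+1 x - u n x| <= K * (q ^+ n - q ^+ n.+1).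
  have -> : K * (q ^+ n - q ^+ n.+1) = q ^+ n * C by rewrite KC exprS; ring.
  elim: n x => [|n IHn] x; first by rewrite subr0 expr0 mul1r F0.
  by rewrite exprS -mulrA; apply: FC => y; exact: IHn.
(* The increments telescope thanks to [C = K * (1 - q)]. *)
have un x n p : `|u (n + p)%N x - u n x| <= K * (q ^+ n - q ^+ (n + p)).
  elim: p => [|p IHp]; first by rewrite addn0 !subrr normr0 mulr0.
  have /ler_normlP[] := u1 (n + p)%N x; move: IHp => /ler_normlP[].
  by rewrite addnS => *; apply/ler_normlP; split; lra.
have K0 : 0 <= K by rewrite divr_ge0// subr_ge0 ltW.
have Kq n : 0 <= K * q ^+ n by rewrite mulr_ge0.
have cu x : cvgn (u ^~ x).
  apply: cauchy_cvg; apply/cauchy_exP => e e0.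
  have : (K * q ^+ n) @[n --> \oo] --> K * 0.
    by apply: cvgMr; apply: cvg_expr; rewrite ger0_norm.
  rewrite mulr0 => /cvgrPdist_lt /(_ _ e0) [N _ /(_ N (leqnn N))].
  rewrite /= sub0r normrN (ger0_norm (Kq _)) => KN.
  exists (u N x); exists N => // n /= Nn; rewrite /ball/=.
  rewrite distrC -(subnKC Nn); apply: le_lt_trans (un _ _ _) _.
  apply: le_lt_trans KN; rewrite ler_wpM2l ?K0//.
  by rewrite gerBl.
pose v x := lim (u ^~ x @ \oo).
have uv x n : `|v x - u n x| <= K * q ^+ n.
  have : (fun p => `|u p x - u n x|) @ \oo --> `|v x - u n x|.
    by apply: cvg_norm; apply: cvgB; [exact: cu|exact: cvg_cst].
  move=> /cvg_lim <- //; apply: limr_le.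
    by apply: is_cvg_norm; apply: is_cvgB; [exact: cu|exact: is_cvg_cst].
  exists n => // p /= np; rewrite -(subnKC np); apply: le_trans (un _ _ _) _.
  by rewrite ler_wpM2l ?K0// gerBl.
exists v; split => // x; first by have := uv x 0%N; rewrite subr0 expr0 mulr1.
(* Since [F (u n) = u n.+1], both [F v] and [v] are within [K * q ^+ n.+1] of [u n.+1]. *)
have Fvv n : `|F v x - v x| <= 2 * K * q ^+ n.+1.
  have /ler_normlP[] := FC v (u n) _ x (uv ^~ n).
  have /ler_normlP[] := uv x n.+1; rewrite exprS /= => *.
  by apply/ler_normlP; split; lra.
apply/eqP; rewrite -subr_eq0 -normr_le0; apply/ler_addgt0Pr => e e0.
have : (2 * K * q ^+ n) @[n --> \oo] --> 2 * K * 0.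
  by apply: cvgMr; apply: cvg_expr; rewrite ger0_norm.
rewrite mulr0 => /cvgrPdist_lt /(_ _ e0) [N _ /(_ N.+1 (leqnSn N))].
rewrite /= sub0r normrN -mulrA (ger0_norm (mulr_ge0 _ (Kq _)))// => KN.
by rewrite add0r; apply: le_trans (ltW KN); rewrite mulrA.
Qed.

End Contraction.

(** * Euclidean geometry of cubes *)

Section Euclid.
Context {R : realType}.

Lemma enorm_ge0 d (x : 'rV[R]_d) : 0 <= enorm x.
Proof. exact: sqrtr_ge0. Qed.

Lemma coord_le_enorm d (x : 'rV[R]_d) i : `|x 0 i| <= enorm x.
Proof.
rewrite -sqrtr_sqr ler_wsqrtr// /dot (bigD1 i)//= -expr2 lerDl.
by apply: sumr_ge0 => j _; rewrite -expr2 sqr_ge0.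
Qed.

Lemma enorm_basisZ d (t : R) (i : 'I_d) : enorm (t *: basis i) = `|t|.
Proof.
rewrite /enorm -sqrtr_sqr; congr Num.sqrt; rewrite /dot (bigD1 i)//= big1.
  by rewrite /basis !mxE !eqxx mulr1 addr0 expr2.
by move=> j ji; rewrite !mxE (negbTE ji) andbF mulr0 mul0r.
Qed.

Lemma dist_ge0 d (x : 'rV[R]_d) S : 0 <= dist x S.
Proof.
rewrite /dist; have [->|/set0P S0] := eqVneq S set0.
  by rewrite image_set0 inf0.
apply: lb_le_inf; first by case: S0 => y Sy; exists (enorm (x - y)), y.
by move=> _ [y _ <-]; exact: enorm_ge0.
Qed.

Lemma dist_le d (x y : 'rV[R]_d) S : S y -> dist x S <= enorm (x - y).
Proof.
move=> Sy; apply: ge_inf; last by exists y.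
by exists 0 => _ [z _ <-]; exact: enorm_ge0.
Qed.

Lemma cube_basis d (i : 'I_d) (r s : R) (x : 'rV[R]_d) : 0 <= s ->
  cube (r - s) x -> cube r (x + s *: basis i) /\ cube r (x - s *: basis i).
Proof.
move=> s0 rx; split=> j; rewrite !mxE eqxx /=;
  have /andP[] := rx j; case: (j == i); rewrite ?(mulr1, mulr0) => *; lra.
Qed.

Lemma cube_sub d (r s : R) (x : 'rV[R]_d) : r <= s -> cube r x -> cube s x.
Proof. by move=> rs rx i; have /andP[*] := rx i; apply/andP; split; lra. Qed.

(** A coordinate violating the bounds of the smaller cube can be pushed by [s] along its axis out of
    [cube r], and this displacement has Euclidean length [s]. *)
Lemma cube_setdist d (r s : R) (K : set 'rV[R]_d) (x : 'rV[R]_d) : 0 <= s ->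
  (s%:E < setdist K (~` cube r))%E -> K x -> cube (r - s) x.
Proof.
move=> s0 sK Kx i; apply: contrapT => ri.
suff [y [ry]] : exists y : 'rV[R]_d, ~ cube r y /\ enorm (x - y) <= s.
  apply/negP; rewrite -ltNge -lte_fin; apply: (lt_le_trans sK).
  by apply: ereal_inf_lbound; exists x => //; exists y.
have dz z : x - (x - z *: basis i) = z *: basis i by rewrite opprB addrC subrK.
have xz z : (x - z *: basis i) 0 i = x 0 i - z by rewrite !mxE !eqxx mulr1.
have [xi|xi] := ltP (r - s) (x 0 i).
  exists (x - (- s) *: basis i); rewrite dz enorm_basisZ normrN ger0_norm//.
  by split => // /(_ i); rewrite xz => /andP[_]; lra.
exists (x - s *: basis i); rewrite dz enorm_basisZ ger0_norm//.
split => // /(_ i); rewrite xz => /andP[? _]; apply: ri; apply/andP; split; lra.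
Qed.

End Euclid.

(** * The scheme as a monotone Bellman map *)

Section Scheme.
Context {R : realType} {d m : nat} (P : model R d m) (HP : standing P).
Notation V := 'rV[R]_d.
Notation W := 'rV[R]_m.
Local Notation A := (ctrls P).
Local Notation b := (drift P).
Local Notation f := (cost P).
Local Notation lam := (lambda P).

(** The lower bound on [Nv] enters here: it makes the weights [Nv P + b_i / 2] and [Nv P - b_i / 2]
    of [nbr_sum] nonnegative, hence the scheme monotone. *)
Lemma drift_coord_le x a i : A a -> `|b x a 0 i| <= 2 * Nv P.
Proof.
move=> Aa; have [M bM] := drift_bounded HP; have N0 := Nv_gt0 HP.
pose B := [set \big[Num.max/0]_(i < d) `|b x a 0 i| | x in setT & a in A].
suff : `|b x a 0 i| <= sup B.
  by move/le_trans; apply; have := Nv_large HP; rewrite -/B; lra.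
apply: le_trans (le_bigmax _ (fun i => `|b x a 0 i|) i) _.
apply: ub_le_sup; last by exists x => //; exists a.
exists (Num.max 0 M) => _ [y _ [a' Aa' <-]].
apply/bigmax_leP; split => [|j _]; first by rewrite le_max lexx.
by rewrite le_max (le_trans (coord_le_enorm _ _) (bM _ _ Aa')) orbT.
Qed.

Lemma cost_le x a : A a -> f x a <= fnorm P.
Proof.
move=> Aa; have [M fM] := cost_bounded HP.
apply: (le_trans (ler_norm _)); apply: ub_le_sup.
  2: by exists x => //; exists a.
exists M => _ [y _ [a' Aa' <-]].
by rewrite ger0_norm ?fM//; exact: (cost_ge0 HP).
Qed.

Lemma enorm_drift_le x a : A a -> enorm (b x a) <= Mb P.
Proof.
move=> Aa; have [M bM] := drift_bounded HP.
apply: ub_le_sup; last by exists x => //; exists a.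
by exists M => _ [y _ [a' Aa' <-]]; exact: bM.
Qed.

(** Over an empty [A] the supremum in [ham] would be 0 by convention, against coercivity. *)
Lemma ctrls_neq0 : A !=set0.
Proof.
have [A0|/set0P//] := eqVneq A set0; exfalso.
have [r Hr] := coercive HP 1; have [_ _ _ [x0 Ox0]] := Omega_domain HP.
have x0c : closure (Omega P) x0 by exact: subset_closure.
have i : 'I_d by case: d (dim_gt0 HP) => // ? _; exact: ord0.
have := Hr x0 (`|r| *: basis i) x0c; rewrite enorm_basisZ normr_id ler_norm.
by move=> /(_ isT); rewrite /ham A0 image_set0 sup0 ler10.
Qed.

Lemma fnorm_ge0 : 0 <= fnorm P.
Proof.
have [a Aa] := ctrls_neq0; apply: le_trans (cost_le 0 Aa).
exact: (cost_ge0 HP).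
Qed.

Lemma pen_ge0 x : 0 <= pen P x.
Proof. by rewrite le_min dist_ge0 ltW// (Mp_gt0 HP). Qed.

Lemma pen_le x : pen P x <= Mp P.
Proof. by rewrite ge_min lexx orbT. Qed.

(** Keeps the argument of the logarithm in (R2) positive. If the drift vanished, [ham] would be at
    most 0 because [f >= 0], against coercivity. *)
Lemma Cext_gt0 : 0 < Cext P.
Proof.
have l0 := lambda_gt0 HP; have f0 := fnorm_ge0.
have [a0 Aa0] := ctrls_neq0.
have M0 : 0 <= Mb P by apply: le_trans (enorm_drift_le 0 Aa0); exact: enorm_ge0.
have d0 := dim_gt0 HP.
suff Mgt : 0 < Mb P.
  rewrite ltr_pwDl ?mulr_ge0// divr_gt0// !mulr_gt0// ?sqrtr_gt0 ?ltr0n//.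
  by rewrite ltr_wpDl// (Mp_gt0 HP).
rewrite lt_neqAle M0 andbT; apply/eqP => M00.
have b0 x a i : A a -> b x a 0 i = 0.
  move=> Aa; apply/eqP; rewrite -normr_le0 M00.
  exact: le_trans (coord_le_enorm _ _) (enorm_drift_le _ Aa).
have [r Hr] := coercive HP 1; have [_ _ _ [x0 Ox0]] := Omega_domain HP.
have x0c : closure (Omega P) x0 by exact: subset_closure.
have i : 'I_d by case: d d0 => // ? _; exact: ord0.
have := Hr x0 (`|r| *: basis i) x0c; rewrite enorm_basisZ normr_id ler_norm.
move=> /(_ isT); apply/negP; rewrite -ltNge (le_lt_trans _ ltr01)//.
apply: ge_sup; first by eexists; exists a0.
move=> _ [a Aa <-]; rewrite /dot big1 => [|j _]; last by rewrite b0// mul0r.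
by rewrite oppr0 add0r oppr_le0 (cost_ge0 HP).
Qed.

(** The coefficient of [v x] in the scheme is [kappa h / h]. *)
Definition kappa (h : R) : R := lam * h + 2 * d%:R * Nv P.

Definition nbr_sum (h : R) (beta : V) (v : V -> R) (x : V) : R :=
  \sum_(i < d) ((Nv P + beta 0 i / 2) * v (x + h *: basis i)
              + (Nv P - beta 0 i / 2) * v (x - h *: basis i)).

(* Solving [L_op = 0] at [x] for [v x]: the result is [gamma_h] times a convex
   combination of the neighbouring values, plus the running cost. *)
Definition bell (eps h : R) (a : W) (v : V -> R) (x : V) : R :=
  (nbr_sum h (b x a) v x + h * (f x a + pen P x / eps)) / kappa h.

Lemma dimN_gt0 : 0 < 2 * d%:R * Nv P.
Proof. by rewrite !mulr_gt0 ?(Nv_gt0 HP)// ltr0n (dim_gt0 HP). Qed.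

Lemma kappa_gt0 h : 0 < h -> 0 < kappa h.
Proof.
by move=> h0; rewrite addr_gt0 ?dimN_gt0// mulr_gt0// (lambda_gt0 HP).
Qed.

Lemma gammaE h : gamma_h P h = (2 * d%:R * Nv P) / kappa h.
Proof. by []. Qed.

Lemma gamma_range h : 0 < h -> 0 <= gamma_h P h < 1.
Proof.
move=> h0; have k0 := kappa_gt0 h0; have N0 := dimN_gt0; rewrite gammaE.
rewrite divr_ge0 ?ltW//= ltr_pdivrMr// mul1r /kappa ltrDr.
by rewrite mulr_gt0// (lambda_gt0 HP).
Qed.

Lemma one_sub_gamma h : 0 < h -> 1 - gamma_h P h = lam * h / kappa h.
Proof.
move=> h0; have k0 := kappa_gt0 h0; rewrite gammaE /kappa.
by field; apply/eqP; move: k0; rewrite /kappa; lra.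
Qed.

Lemma L_opE eps h pi v x : 0 < h ->
  L_op P eps h pi v x = kappa h / h * (v x - bell eps h (pi x) v x).
Proof.
move=> h0; have k0 := kappa_gt0 h0.
(* The viscosity is [Nv P * h], so [h] times the drift and viscous terms has weights of order one:
   [Nv P + b_i / 2] and [Nv P - b_i / 2] at the neighbours, [- 2dN] at the centre. *)
have Ens : nbr_sum h (b x (pi x)) v x = h * (dot (b x (pi x)) (grad_h h v x)
    + nu_h P h * lap_h h v x) + 2 * d%:R * Nv P * v x.
  have -> : 2 * d%:R * Nv P * v x = \sum_(i < d) (2 * Nv P * v x).
    by rewrite sumr_const card_ord -[RHS]mulr_natr; ring.
  rewrite /nu_h /lap_h /dot mulr_sumr -big_split mulr_sumr -big_split.
  apply: eq_bigr => i _; rewrite /= !mxE.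
  by field; rewrite gt_eqF.
rewrite /bell Ens /L_op /kappa; set c := pen P x / eps; field.
by rewrite !gt_eqF.
Qed.

(** Nonnegative weights give monotonicity, and their total [2dN] lets [M] come out with factor
    [2dN / kappa h]. Only neighbours of [x] are compared, which is what localization to cubes
    requires. *)
Lemma bell_le eps h a v w M x : 0 < h -> A a ->
  (forall i, v (x + h *: basis i) <= w (x + h *: basis i) + M) ->
  (forall i, v (x - h *: basis i) <= w (x - h *: basis i) + M) ->
  bell eps h a v x <= bell eps h a w x + gamma_h P h * M.
Proof.
move=> h0 Aa vw1 vw2; have k0 := kappa_gt0 h0.
rewrite gammaE /bell; set c := h * _.
have -> :
    (nbr_sum h (b x a) w x + c) / kappa h + 2 * d%:R * Nv P / kappa h * M =
    (nbr_sum h (b x a) w x + 2 * d%:R * Nv P * M + c) / kappa h by ring.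
rewrite ler_pM2r ?invr_gt0// lerD2r /nbr_sum.
have -> : 2 * d%:R * Nv P * M = \sum_(i < d) (2 * Nv P * M).
  by rewrite sumr_const card_ord -[RHS]mulr_natr; ring.
rewrite -big_split; apply: ler_sum => i _ /=.
have /ler_normlP[b1 b2] := drift_coord_le x i Aa.
set p := v _; set q := v _.
have := ler_wpM2l _ (vw1 i) (x := Nv P + b x a 0 i / 2).
have := ler_wpM2l _ (vw2 i) (x := Nv P - b x a 0 i / 2).
rewrite -/p -/q; move=> /(_ ltac:(lra)) + /(_ ltac:(lra)); lra.
Qed.

Lemma bell_abs eps h a v w M x : 0 < h -> A a ->
  (forall y, `|v y - w y| <= M) ->
  `|bell eps h a v x - bell eps h a w x| <= gamma_h P h * M.
Proof.
move=> h0 Aa vw.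
have vw1 y : v y <= w y + M by have /ler_normlP[_] := vw y; lra.
have vw2 y : w y <= v y + M by have /ler_normlP[] := vw y; lra.
have := bell_le eps h0 Aa (v := w) (w := v) (M := M) (x := x) (fun i => vw2 _)
  (fun i => vw2 _).
have := bell_le eps h0 Aa (v := v) (w := w) (M := M) (x := x) (fun i => vw1 _)
  (fun i => vw1 _).
by move=> *; apply/ler_normlP; split; lra.
Qed.

Lemma bell_cst eps h a c x :
  bell eps h a (cst c) x
    = gamma_h P h * c + h * (f x a + pen P x / eps) / kappa h.
Proof.
rewrite /bell gammaE mulrDl; congr (_ + _).
rewrite mulrAC; congr (_ / _); rewrite /nbr_sum /=.
rewrite (eq_bigr (fun=> 2 * Nv P * c)) => [|i _]; last by ring.
by rewrite sumr_const card_ord -[LHS]mulr_natr; ring.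
Qed.

(** The discounted cost of always paying the largest running cost. As a constant it is fixed by the
    Bellman map with that running cost. *)
Definition vbound (eps : R) : R := (fnorm P + Mp P / eps) / lam.

Lemma vbound_ge0 eps : 0 < eps -> 0 <= vbound eps.
Proof.
move=> e0; rewrite divr_ge0 ?addr_ge0 ?fnorm_ge0 ?(ltW (lambda_gt0 HP))//.
by rewrite divr_ge0 ?(ltW (Mp_gt0 HP)) ?(ltW e0).
Qed.

Lemma bell_cost_ge0 eps h a x : 0 < h -> 0 < eps -> A a ->
  0 <= h * (f x a + pen P x / eps) / kappa h.
Proof.
move=> h0 e0 Aa; have k0 := kappa_gt0 h0.
rewrite divr_ge0 ?mulr_ge0 ?(ltW h0) ?(ltW k0)// addr_ge0 ?(cost_ge0 HP)//.
by rewrite divr_ge0 ?pen_ge0 ?(ltW e0).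
Qed.

Lemma bell_cost_le eps h a x : 0 < h -> 0 < eps -> A a ->
  h * (f x a + pen P x / eps) / kappa h <= (1 - gamma_h P h) * vbound eps.
Proof.
move=> h0 e0 Aa; have k0 := kappa_gt0 h0; have l0 := lambda_gt0 HP.
rewrite one_sub_gamma// /vbound.
have -> : lam * h / kappa h * ((fnorm P + Mp P / eps) / lam) =
    h * (fnorm P + Mp P / eps) / kappa h by field; rewrite !gt_eqF.
rewrite ler_pM2r ?invr_gt0// ler_pM2l// lerD ?cost_le//.
by rewrite ler_pM2r ?invr_gt0// pen_le.
Qed.

End Scheme.

(** * Borel measurability and dense sequences of controls *)

Section BorelFunctions.
Context {R : realType}.

Lemma measurable_fun_gt d (T : measurableType d) (g : T -> R) :
  (forall r, measurable [set x | r < g x]) -> measurable_fun setT g.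
Proof.
move=> mg; apply: (measurability _ (RGenOInfty.measurableE R)).
move=> _ [_ [r ->] <-]; rewrite setTI.
by rewrite (_ : _ @^-1` _ = [set x | r < g x])//; apply/seteqP; split => x /=;
  rewrite in_itv/= andbT.
Qed.

Lemma measurable_fun_lt d (T : measurableType d) (g : T -> R) :
  (forall r, measurable [set x | g x < r]) -> measurable_fun setT g.
Proof.
move=> mg; apply: (measurability _ (RGenInftyO.measurableE R)).
move=> _ [_ [r ->] <-]; rewrite setTI.
by rewrite (_ : _ @^-1` _ = [set x | g x < r])//; apply/seteqP; split => x /=;
  rewrite in_itv.
Qed.

Lemma open_borel (T : ptopologicalType) (U : set T) : open U ->
  measurable (U : set (Borel T)).
Proof. exact: sub_sigma_algebra. Qed.

Lemma closed_borel (T : ptopologicalType) (U : set T) : closed U ->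
  measurable (U : set (Borel T)).
Proof.
move=> cU; rewrite -(setCK U); apply: measurableC.
by apply: open_borel; exact: closed_openC.
Qed.

Lemma continuous_borel (T : ptopologicalType) (g : T -> R) : continuous g ->
  measurable_fun [set: Borel T] (g : Borel T -> R).
Proof.
move=> cg; apply: measurable_fun_gt => r; apply: open_borel.
by rewrite (_ : [set x | _] = g @^-1` [set y | r < y])//;
  apply: open_comp => //;
  exact: open_gt.
Qed.

Lemma shift_continuous d (c : 'rV[R]_d) :
  continuous (fun x : 'rV[R]_d => x + c).
Proof.
move=> x.
by apply: (@cvgD _ _ _ (nbhs x) _ id (cst c)); [exact: cvg_id|exact: cvg_cst].
Qed.

Lemma measurable_shift d (v : 'rV[R]_d -> R) (c : 'rV[R]_d) :
  measurable_fun [set: Borel 'rV[R]_d] (v : Borel 'rV[R]_d -> R) ->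
  measurable_fun [set: Borel 'rV[R]_d]
    ((fun x => v (x + c)) : Borel 'rV[R]_d -> R).
Proof.
move=> mv; pose sh (x : Borel 'rV[R]_d) : Borel 'rV[R]_d := x + c.
suff msh : measurable_fun setT sh by exact: measurableT_comp mv msh.
apply: (@measurability _ _ _ _ setT sh (@open 'rV[R]_d) erefl).
move=> _ [U oU <-]; rewrite setTI; apply: open_borel.
apply: (@open_comp _ _ (fun x : 'rV[R]_d => x + c)) => // x _.
exact: shift_continuous.
Qed.

Lemma enorm_continuous d : continuous (@enorm R d).
Proof.
have cdot : continuous (fun y : 'rV[R]_d => dot y y).
  apply: continuous_big => [|i _ y]; first exact: add_continuous.
  apply: (@cvgM _ _ (nbhs y)); exact: coord_continuous.
move=> x; apply: (@continuous_comp _ _ _ (fun y : 'rV[R]_d => dot y y)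
  (@Num.sqrt R)).
  exact: cdot.
exact: sqrt_continuous.
Qed.

Lemma measurable_dist d (S : set 'rV[R]_d) : S !=set0 ->
  measurable_fun [set: Borel 'rV[R]_d]
    ((fun x : 'rV[R]_d => dist x S) : Borel 'rV[R]_d -> R).
Proof.
move=> [y0 Sy0]; apply: measurable_fun_lt => r; apply: open_borel.
rewrite (_ : mkset _ = \bigcup_(y in S) [set x | enorm (x - y) < r]).
  apply: bigcup_open => y _.
  have cy : continuous (fun x : 'rV[R]_d => enorm (x - y)).
    move=> x.
    apply: (@continuous_comp _ _ _ (fun x : 'rV[R]_d => x - y) (@enorm R d)).
      exact: shift_continuous.
    exact: enorm_continuous.
  have oc := @open_comp _ _ (fun x : 'rV[R]_d => enorm (x - y)) [set z | z < r].
  by apply: oc => [x _|]; [exact: cy|exact: open_lt].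
apply/seteqP; split => x /=; last first.
  by move=> [y Sy]; apply: le_lt_trans; apply: dist_le.
move=> /inf_lt[|_ [y Sy <-]]; last by exists y.
by exists (enorm (x - y0)), y0.
Qed.

Lemma inv_nat_lt (e : R) : 0 < e -> exists n, n.+1%:R^-1 < e.
Proof.
move=> e0; exists (Num.bound e^-1).
rewrite invf_plt ?posrE// (lt_le_trans (archi_boundP _)) ?ler_nat//.
by rewrite invr_ge0 ltW.
Qed.

(** A countable dense subset turns extrema over [A] into countable ones, which preserve
    measurability. It collects the centres of finite covers by balls of radius [1 / (n + 1)]. *)
Lemma compact_dense_seq m (A : set 'rV[R]_m) : compact A -> A !=set0 ->
  exists s : nat -> 'rV[R]_m, (forall n, A (s n)) /\
    forall a e, A a -> 0 < e -> exists n, `|a - s n| < e.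
Proof.
rewrite compact_cover => cA [a0 Aa0].
have /choice[F HF] n : exists F : seq 'rV[R]_m, {in F, forall y, A y} /\
    forall a, A a -> exists2 y, y \in F & ball y n.+1%:R^-1 a.
  have [|y Ay|F FA AF] := cA _ A (fun y => ball y n.+1%:R^-1).
  - by move=> y _; exact: ball_open.
  - by exists y => //; exact: ballxx.
  - by exists (finmap.enum_fset F); split => [y /FA/set_mem//|a /AF[y]];
    exists y.
(* A code of [(n, i)] gives the [i]-th centre of the [n]-th cover; every failed lookup falls back on
   [a0], which lies in [A]. *)
pose s k := if unpickle k is Some (n, i) then nth a0 (F n) i else a0.
exists s; split => [k|a e Aa e0].
  rewrite /s; case: unpickle => // -[n i].
  have [iF|iF] := ltnP i (size (F n)); last by rewrite nth_default.
  by apply: (HF n).1; exact: mem_nth.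
have [n ne] := inv_nat_lt e0.
have [y yF ya] := (HF n).2 a Aa.
exists (pickle (n, index y (F n))); rewrite /s pickleK nth_index//.
by apply: lt_trans ne; rewrite distrC; move: ya; rewrite -ball_normE.
Qed.

(* Only separate continuity in [a] and measurability in [x] are needed: a near
   point [s k] of [pi x] detects whether [g x] exceeds [r] around [pi x]. *)
Lemma measurable_caratheodory d (T : measurableType d) m (A : set 'rV[R]_m)
    (s : nat -> 'rV[R]_m) (g : T -> 'rV[R]_m -> R) (pi : T -> 'rV[R]_m) :
  (forall n, A (s n)) ->
  (forall a e, A a -> 0 < e -> exists n, `|a - s n| < e) ->
  (forall n, measurable_fun setT (g ^~ (s n))) ->
  (forall x a, A a -> g x a' @[a' --> within A (nbhs a)] --> g x a) ->
  measurable_fun setT (pi : T -> Borel 'rV[R]_m) -> (forall x, A (pi x)) ->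
  measurable_fun setT (fun x => g x (pi x)).
Proof.
move=> As ds mg cg mpi Api; apply: measurable_fun_gt => r.
rewrite (_ : mkset _ = \bigcup_n \bigcup_k
  ([set x | `|s k - pi x| < n.+1%:R^-1] `&`
   \bigcap_(j in [set j | `|s k - s j| < n.+1%:R^-1])
     [set x | r + n.+1%:R^-1 <= g x (s j)])).
  apply: bigcupT_measurable => n; apply: bigcupT_measurable => k.
  apply: measurableI.
    rewrite (_ : mkset _ = pi @^-1` (ball (s k) n.+1%:R^-1)).
      by rewrite -[X in measurable X]setTI; apply: mpi => //;
        apply: open_borel; exact: ball_open.
    by rewrite -ball_normE.
  apply: bigcap_measurable => [|j _].
    by exists k; rewrite /= subrr normr0.
  rewrite (_ : mkset _ = (g ^~ (s j)) @^-1` `[r + n.+1%:R^-1, +oo[%classic).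
    by rewrite -[X in measurable X]setTI; apply: mg.
  by apply/seteqP; split => x /=; rewrite in_itv/= andbT.
have inv0 n : 0 < n.+1%:R^-1 :> R by rewrite invr_gt0.
apply/seteqP; split => x /=; last first.
  move=> [n _ [k _ [/= kx jx]]].
  have /cvgrPdist_lt /(_ _ (inv0 n)) := cg x _ (Api x).
  rewrite near_withinE => /nbhs_ballP[e /= e0 He].
  (* The radius brings [s j] close enough to [pi x] for continuity and, by the triangle inequality,
     within [1 / (n + 1)] of [s k]. *)
  have [|j jpi] := ds _ (Num.min e (n.+1%:R^-1 - `|s k - pi x|)) (Api x).
    by rewrite lt_min e0 subr_gt0.
  move: jpi; rewrite lt_min => /andP[je jk].
  have pij : `|g x (pi x) - g x (s j)| < n.+1%:R^-1.
    by apply: He => //; rewrite -ball_normE.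
  move: pij; rewrite ltr_norml => /andP[pij _].
  pose q : R := n.+1%:R^-1.
  have {}pij : - q < g x (pi x) - g x (s j) := pij.
  suff : r + q <= g x (s j) by move: q pij => *; lra.
  apply: jx => /=; rewrite -(subrK (pi x) (s k)) -addrA.
  by apply: le_lt_trans (ler_normD _ _) _; rewrite -ltrBrDl.
move=> rg; have e0 : 0 < (g x (pi x) - r) / 2 by rewrite divr_gt0// subr_gt0.
have /cvgrPdist_lt /(_ _ e0) := cg x _ (Api x).
rewrite near_withinE => /nbhs_ballP[e /= e1 He].
(* Below [e / 2], two successive moves from [pi x] stay within [e]; below half the gap, the margin
   [r + 1 / (n + 1)] survives a variation of [g] by the other half. *)
have [|n]   := @inv_nat_lt (Num.min (e / 2) ((g x (pi x) - r) / 2)).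
  by rewrite lt_min e0 divr_gt0.
rewrite lt_min => /andP[ne ng].
have [k kn] := ds _ _ (Api x) (inv0 n).
exists n => //; exists k => //; split; first by rewrite /= distrC.
move=> j /= kj.
have : `|g x (pi x) - g x (s j)| < (g x (pi x) - r) / 2.
  apply: He => //; rewrite -ball_normE /= -(subrK (s k) (pi x)) -addrA.
  apply: le_lt_trans (ler_normD _ _) _.
  by rewrite (splitr e) ltrD// (lt_trans _ ne).
rewrite ltr_norml => /andP[_ gj].
have {}gj : g x (pi x) - g x (s j) < (g x (pi x) - r) / 2 := gj.
pose q : R := n.+1%:R^-1; have {}ng : q < (g x (pi x) - r) / 2 := ng.
by suff : r + q <= g x (s j) by []; move: q ng gj => *; lra.
Qed.

End BorelFunctions.

(** * Policy values and the scheme solution as Borel fixed points *)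

Section Values.
Context {R : realType} {d m : nat} (P : model R d m) (HP : standing P).
Notation V := 'rV[R]_d.
Notation W := 'rV[R]_m.
Local Notation A := (ctrls P).
Local Notation b := (drift P).
Local Notation f := (cost P).
Local Notation lam := (lambda P).
Local Notation borel v := (measurable_fun [set: Borel V] (v : Borel V -> R)).

Lemma borelD (v w : V -> R) : borel v -> borel w -> borel (fun x => v x + w x).
Proof. exact: measurable_funD. Qed.

Lemma borelM (v w : V -> R) : borel v -> borel w -> borel (fun x => v x * w x).
Proof. exact: measurable_funM. Qed.

Lemma borel_cst (c : R) : borel (fun=> c).
Proof. exact: measurable_cst. Qed.

Lemma borel_cvg (u : nat -> V -> R) (v : V -> R) : (forall n, borel (u n)) ->
  (forall x, u n x @[n --> \oo] --> v x) -> borel v.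
Proof. by move=> mu uv; exact: (measurable_fun_cvg mu (fun x _ => uv x)). Qed.

Lemma borel_lt (v : V -> R) r : borel v ->
  measurable ([set x | v x < r] : set (Borel V)).
Proof.
move=> mv; have := mv measurableT `]-oo, r[%classic (measurable_itv _).
by rewrite setTI set_itvE.
Qed.

Lemma within_slice_ctrl (T : topologicalType) (g : V -> W -> T) x a :
  {within [set z : V * W | A z.2], continuous (fun z => g z.1 z.2)} ->
  A a -> g x a' @[a' --> within A (nbhs a)] --> g x a.
Proof.
move=> /subspace_continuousP /(_ (x, a)) + Aa; move/(_ Aa) => cg Q /cg.
have ca : (fun a' => (x, a')) @ nbhs a --> (x, a).
  move=> Q' [[Q1 Q2] [/= Q1x Q2a] sub]; apply: filterS Q2a => a' Q2a'.
  by apply: sub; split => //=; exact: nbhs_singleton.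
by move=> /ca.
Qed.

Lemma within_slice_state (T : topologicalType) (g : V -> W -> T) a :
  {within [set z : V * W | A z.2], continuous (fun z => g z.1 z.2)} ->
  A a -> continuous (g ^~ a).
Proof.
move=> /subspace_continuousP cg Aa x Q /(cg (x, a) Aa).
have ca : (fun x' => (x', a)) @ nbhs x --> (x, a).
  move=> Q' [[Q1 Q2] [/= Q1x Q2a] sub]; apply: filterS Q1x => x' Q1x'.
  by apply: sub; split => //=; exact: nbhs_singleton.
move=> /ca cQ; have {}cQ : nbhs x [set x' | A a -> Q (g x' a)] := cQ.
by apply: filterS cQ => x' /=; apply.
Qed.

Lemma drift_coord_cvg x a i : A a ->
  b x a' 0 i @[a' --> within A (nbhs a)] --> b x a 0 i.
Proof.
move=> Aa; have cb := within_slice_ctrl (x := x) (drift_continuous HP) Aa.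
exact: cvg_comp cb (@coord_continuous _ _ _ 0 i (b x a)).
Qed.

Lemma drift_coord_borel a i : A a -> borel (fun x => b x a 0 i).
Proof.
move=> Aa; apply: continuous_borel => x.
have cb := within_slice_state (drift_continuous HP) Aa.
exact: cvg_comp (cb x) (@coord_continuous _ _ _ 0 i (b x a)).
Qed.

Lemma pen_borel : borel (pen P).
Proof.
have [_ _ _ [x0 Ox0]] := Omega_domain HP.
have md : borel (fun x => dist x (closure (Omega P))).
  by apply: measurable_dist; exists x0; exact: subset_closure.
exact: measurable_minr md (measurable_cst (Mp P)).
Qed.

Lemma bell_cvg eps h v x a : A a ->
  bell P eps h a' v x @[a' --> within A (nbhs a)] --> bell P eps h a v x.
Proof.
move=> Aa; apply: cvgM; last exact: cvg_cst.
apply: cvgD; last first.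
  apply: cvgM; first exact: cvg_cst.
  apply: cvgD; last exact: cvg_cst.
  exact: within_slice_ctrl (cost_continuous HP) Aa.
apply: cvg_big => [|i _]; first exact: add_continuous.
have bi := drift_coord_cvg (x := x) (i := i) Aa.
have b2 : b x a' 0 i / 2 @[a' --> within A (nbhs a)] --> b x a 0 i / 2.
  by apply: cvgM => //; exact: cvg_cst.
apply: cvgD; (apply: cvgM; last exact: cvg_cst).
  by apply: cvgD => //; exact: cvg_cst.
by apply: cvgB => //; exact: cvg_cst.
Qed.

Lemma bell_borel eps h v a : A a -> borel v -> borel (bell P eps h a v).
Proof.
move=> Aa mv; apply: borelM; last exact: borel_cst.
apply: borelD; last first.
  apply: borelM; first exact: borel_cst.
  apply: borelD; last by apply: borelM; [exact: pen_borel|exact: borel_cst].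
  by apply: continuous_borel; exact: within_slice_state (cost_continuous HP) Aa.
apply: measurable_sum => i.
have mb : borel (fun x => b x a 0 i / 2).
  by apply: borelM; [exact: drift_coord_borel|exact: borel_cst].
apply: borelD; (apply: borelM; last exact: measurable_shift).
  by apply: borelD => //; exact: borel_cst.
apply: borelD; first exact: borel_cst.
exact: (measurableT_comp (@oppr_measurable R _) mb).
Qed.

Lemma bell_policy_borel eps h v pi : policy P pi -> borel v ->
  borel (fun x => bell P eps h (pi x) v x).
Proof.
move=> [mpi Api] mv.
have [s [As ds]] := compact_dense_seq (ctrls_compact HP) (ctrls_neq0 HP).
have mc := @measurable_caratheodory R _ (Borel V) m A s
  (fun x a => bell P eps h a v x) pi As ds.
by apply: mc => // [n|x a]; [exact: bell_borel|exact: bell_cvg].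
Qed.

(** Existence is what makes [get] return a solution. The fixed point is Borel as a pointwise limit
    of iterates from 0, each of them Borel by [bell_policy_borel]. *)
Lemma policy_value_spec eps h pi : 0 < h -> 0 < eps -> policy P pi ->
  bounded_borel (policy_value P eps h pi) /\
  forall x, policy_value P eps h pi x
    = bell P eps h (pi x) (policy_value P eps h pi) x.
Proof.
move=> h0 e0 pp; have [mpi Api] := pp.
suff : exists v, bounded_borel v /\ forall x, L_op P eps h pi v x = 0.
  move=> /getPex[bv Lv]; split => // x; have := Lv x.
  rewrite L_opE// => /eqP; rewrite mulf_eq0 gt_eqF ?divr_gt0 ?(kappa_gt0 HP)//=.
  by rewrite subr_eq0 => /eqP.
pose F v x := bell P eps h (pi x) v x.
have g01 := gamma_range HP h0.
have [v [vB Fv vl]] : exists v : V -> R,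
    [/\ forall x, `|v x| <= ((1 - gamma_h P h) * vbound P eps)
      / (1 - gamma_h P h),
        forall x, F v x = v x
      & forall x, iter n F (cst 0) x @[n --> \oo] --> v x].
  apply: contraction_fixpoint => //.
  - by rewrite mulr_ge0 ?(vbound_ge0 HP)// subr_ge0 ltW//; case/andP: g01.
  - by move=> v w M x; exact: bell_abs.
  - move=> x; rewrite /F bell_cst mulr0 add0r ger0_norm ?(bell_cost_ge0 HP)//.
    exact: bell_cost_le.
exists v; split; last by move=> x; rewrite L_opE// -/(F v x) Fv subrr mulr0.
split; first by eexists; exact: vB.
apply: borel_cvg vl; elim=> [|n IHn]; first exact: borel_cst.
exact: bell_policy_borel.
Qed.

Lemma ham_ub x p : has_ubound [set - dot (b x a) p - f x a | a in A].
Proof.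
exists (\sum_(i < d) 2 * Nv P * `|p 0 i|) => _ [a Aa <-].
rewrite lerBlDr (le_trans (ler_norm _))// normrN.
apply: le_trans (ler_norm_sum _ _ _) _; apply: ler_wpDr.
  exact: (cost_ge0 HP).
by apply: ler_sum => i _; rewrite normrM ler_wpM2r// (drift_coord_le HP).
Qed.

Lemma L_op_cstE eps h a v x : L_op P eps h (cst a) v x =
  lam * v x - nu_h P h * lap_h h v x - pen P x / eps
  + (- dot (b x a) (grad_h h v x) - f x a).
Proof. by rewrite /L_op; set c := pen P x / eps; rewrite /=; ring. Qed.

Lemma F_opE eps h v x : F_op P eps h v x =
  lam * v x - nu_h P h * lap_h h v x - pen P x / eps + ham P x (grad_h h v x).
Proof. by rewrite /F_op; set c := pen P x / eps; ring. Qed.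

Lemma L_op_le_F_op eps h a v x : A a ->
  L_op P eps h (cst a) v x <= F_op P eps h v x.
Proof.
move=> Aa; rewrite L_op_cstE F_opE lerD2l.
by apply: ub_le_sup; [exact: ham_ub|exists a].
Qed.

(** A near-maximiser stands in for a maximiser of the Hamiltonian; the slack is later sent to 0 or
    absorbed by a strict inequality. *)
Lemma F_op_near eps h v x e : 0 < e ->
  exists2 a, A a & F_op P eps h v x <= L_op P eps h (cst a) v x + e.
Proof.
move=> e0; have [a0 Aa0] := ctrls_neq0 HP.
have /(sup_adherent e0)[_ [a Aa <-] He] :
    has_sup [set - dot (b x a) (grad_h h v x) - f x a | a in A].
  by split; [eexists; exists a0|exact: ham_ub].
exists a => //; rewrite L_op_cstE F_opE -[X in _ <= X]addrA lerD2l.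
by rewrite ltW// -ltrBlDr.
Qed.

(** This is the infimum over [A] of the maps [bell], by [bellF_le] and [bellF_near]. Written through
    [F_op], its fixed points are visibly the zeros of [F_op]. *)
Definition bellF (eps h : R) (v : V -> R) (x : V) : R :=
  v x - h / kappa P h * F_op P eps h v x.

Lemma hk_gt0 h : 0 < h -> 0 < h / kappa P h.
Proof. by move=> h0; rewrite divr_gt0// (kappa_gt0 HP). Qed.

Lemma bell_L_opE eps h a v x : 0 < h ->
  bell P eps h a v x = v x - h / kappa P h * L_op P eps h (cst a) v x.
Proof.
move=> h0; rewrite L_opE//= mulrA.
rewrite -[h / _ * _]/(h / kappa P h * (kappa P h / h)).
by rewrite mulrA divfK ?divff ?mul1r ?opprB ?subrKC ?gt_eqF ?(kappa_gt0 HP).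
Qed.

Lemma bellF_le eps h a v x : 0 < h -> A a ->
  bellF eps h v x <= bell P eps h a v x.
Proof.
move=> h0 Aa; rewrite bell_L_opE// lerD2l lerN2 ler_pM2l ?hk_gt0//.
exact: L_op_le_F_op.
Qed.

Lemma bellF_near eps h v x e : 0 < h -> 0 < e ->
  exists2 a, A a & bell P eps h a v x <= bellF eps h v x + e.
Proof.
move=> h0 e0; have k0 := hk_gt0 h0.
have [|a Aa Fa] := @F_op_near eps h v x (e / (h / kappa P h)).
  by rewrite divr_gt0.
exists a => //; rewrite bell_L_opE// /bellF -addrA lerD2l.
move: k0 Fa; set k := h / _ => k0 /(ler_wpM2l (ltW k0)).
by rewrite [X in _ <= X]mulrDr [k * (e / k)]mulrCA divff ?mulr1 ?gt_eqF//; lra.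
Qed.

Lemma bellF_abs eps h v w M x : 0 < h -> (forall y, `|v y - w y| <= M) ->
  `|bellF eps h v x - bellF eps h w x| <= gamma_h P h * M.
Proof.
move=> h0 vw; apply/ler_addgt0Pr => e e0.
have [a Aa va] := bellF_near eps v x h0 e0.
have [a' Aa' wa] := bellF_near eps w x h0 e0.
have := bellF_le eps v x h0 Aa'; have := bellF_le eps w x h0 Aa.
have /ler_normlP[] := bell_abs HP eps x h0 Aa vw.
have /ler_normlP[] := bell_abs HP eps x h0 Aa' vw.
by move=> *; apply/ler_normlP; split; lra.
Qed.

(** Continuity in the control moves an almost optimal control into the dense sequence. Strict
    sublevel sets of [bellF] become countable unions, and a greedy control can be chosen by first
    index. *)
Lemma bellF_lt_dense eps h v x r (s : nat -> W) :
  0 < h -> (forall n, A (s n)) ->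
  (forall a e, A a -> 0 < e -> exists n, `|a - s n| < e) ->
  bellF eps h v x < r -> exists n, bell P eps h (s n) v x < r.
Proof.
move=> h0 As ds Fr; have e0 : 0 < (r - bellF eps h v x) / 2.
  by rewrite divr_gt0// subr_gt0.
have [a Aa Fa] := bellF_near eps v x h0 e0.
have ar : 0 < r - bell P eps h a v x by lra.
have /cvgrPdist_lt /(_ _ ar) := @bell_cvg eps h v x a Aa.
rewrite near_withinE => /nbhs_ballP[q /= q0 Hq].
have [n an] := ds a q Aa q0; exists n.
have : `|bell P eps h a v x - bell P eps h (s n) v x| < r - bell P eps h a v x.
  by apply: Hq => //; rewrite -ball_normE.
by rewrite distrC => /(le_lt_trans (ler_norm _)); rewrite ltrD2r.
Qed.

Lemma bellF_borel eps h v : 0 < h -> borel v -> borel (bellF eps h v).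
Proof.
move=> h0 mv; apply: measurable_fun_lt => r.
have [s [As ds]] := compact_dense_seq (ctrls_compact HP) (ctrls_neq0 HP).
rewrite (_ : mkset _ = \bigcup_n [set x | bell P eps h (s n) v x < r]).
  apply: bigcupT_measurable => n.
  by apply: borel_lt; exact: bell_borel.
apply/seteqP; split => x /=; last first.
  by move=> [n _]; apply: le_lt_trans; exact: bellF_le.
by move=> /(bellF_lt_dense h0 As ds)[n]; exists n.
Qed.

Lemma v_scheme_spec eps h : 0 < h -> 0 < eps ->
  bounded_borel (v_scheme P eps h) /\
  forall x, v_scheme P eps h x = bellF eps h (v_scheme P eps h) x.
Proof.
move=> h0 e0; have k0 := hk_gt0 h0.
suff : exists v, bounded_borel v /\ forall x, F_op P eps h v x = 0.
  by move=> /getPex[bv Fv]; split => // x; rewrite /bellF Fv mulr0 subr0.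
have g01 := gamma_range HP h0.
have [v [vB Fv vl]] : exists v : V -> R,
    [/\ forall x, `|v x| <= ((1 - gamma_h P h) * vbound P eps)
      / (1 - gamma_h P h),
        forall x, bellF eps h v x = v x
      & forall x, iter n (bellF eps h) (cst 0) x @[n --> \oo] --> v x].
  apply: contraction_fixpoint => //.
  - by rewrite mulr_ge0 ?(vbound_ge0 HP)// subr_ge0 ltW//; case/andP: g01.
  - by move=> v w M x; exact: bellF_abs.
  - move=> x; rewrite ger0_norm.
      have [a Aa] := ctrls_neq0 HP.
      apply: (le_trans (bellF_le _ _ _ h0 Aa)).
      by rewrite bell_cst mulr0 add0r bell_cost_le.
    apply/ler_addgt0Pr => e e1; have [a Aa] := bellF_near eps (cst 0) x h0 e1.
    by apply: le_trans; rewrite bell_cst mulr0 add0r (bell_cost_ge0 HP).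
exists v; split; last first.
  move=> x; have /eqP := Fv x;
    rewrite /bellF -subr_eq0 addrAC subrr add0r oppr_eq0.
  by rewrite mulf_eq0 (gt_eqF k0) => /eqP.
split; first by eexists; exact: vB.
apply: borel_cvg vl; elim=> [|n IHn]; first exact: borel_cst.
exact: bellF_borel.
Qed.

End Values.

(** * Localized policies and approximate policy iteration *)

Section PolicyIteration.
Context {R : realType} {d m : nat} (P : model R d m) (HP : standing P).
Notation V := 'rV[R]_d.
Notation W := 'rV[R]_m.
Local Notation A := (ctrls P).
Local Notation borel v := (measurable_fun [set: Borel V] (v : Borel V -> R)).
Context (eps h L : R) (h0 : 0 < h) (e0 : 0 < eps).
Local Notation S := (policy_value P eps h).
Local Notation q := (gamma_h P h).
Local Notation B := (vbound P eps).
Local Notation vh := (v_scheme P eps h).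
Local Notation bell a v x := (bell P eps h a v x).

Lemma policy_value_ge0 pi x : policy P pi -> 0 <= S pi x.
Proof.
move=> pp; have [[[M SM] _] SE] := policy_value_spec HP h0 e0 pp.
(* Writing [0] as [0 / (1 - q)] puts the goal in the form of [contraction_ub] with [beta = 0]; the
   next three bounds follow the same pattern. *)
rewrite -oppr_le0 -[X in _ <= X](mul0r (1 - q)^-1).
apply: (contraction_ub (z := fun x => - S pi x) (gamma_range HP h0)).
  by exists M => y; rewrite (le_trans (ler_norm _))// normrN.
move=> K SK y; rewrite addr0 {1}SE.
have nb z : cst 0 z <= S pi z + K by have := SK z; rewrite /=; lra.
have := bell_le HP eps (x := y) h0 (pp.2 y) (fun i => nb _) (fun i => nb _).
rewrite bell_cst mulr0 add0r.
by have := bell_cost_ge0 HP y h0 e0 (pp.2 y); lra.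
Qed.

Lemma policy_value_le pi x : policy P pi -> S pi x <= B.
Proof.
move=> pp; have [[[M SM] _] SE] := policy_value_spec HP h0 e0 pp.
rewrite -subr_le0 -[X in _ <= X](mul0r (1 - q)^-1).
apply: (contraction_ub (z := fun x => S pi x - B) (gamma_range HP h0)).
  by exists (M - B) => y; rewrite lerD2r (le_trans (ler_norm _)).
move=> K SK y; rewrite addr0 {1}SE.
have nb z : S pi z <= cst B z + K by have := SK z; rewrite /=; lra.
have := bell_le HP eps (x := y) h0 (pp.2 y) (fun i => nb _) (fun i => nb _).
rewrite bell_cst.
by have := bell_cost_le HP y h0 e0 (pp.2 y); lra.
Qed.

Lemma v_scheme_ge0 x : 0 <= vh x.
Proof.
have [[[M SM] _] SE] := v_scheme_spec HP h0 e0.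
rewrite -oppr_le0 -[X in _ <= X](mul0r (1 - q)^-1).
apply: (contraction_ub (z := fun x => - vh x) (gamma_range HP h0)).
  by exists M => y; rewrite (le_trans (ler_norm _))// normrN.
move=> K SK y; rewrite addr0; apply/ler_addgt0Pr => e e1.
have [a Aa] := bellF_near HP eps vh y h0 e1; rewrite -SE.
have nb z : cst 0 z <= vh z + K by have := SK z; rewrite /=; lra.
have := bell_le HP eps (x := y) h0 Aa (fun i => nb _) (fun i => nb _).
rewrite bell_cst mulr0 add0r.
by have := bell_cost_ge0 HP y h0 e0 Aa; lra.
Qed.

Lemma v_scheme_le_policy_value pi x : policy P pi -> vh x <= S pi x.
Proof.
move=> pp; have [[[M SM] _] SE] := policy_value_spec HP h0 e0 pp.
have [[[M' vM] _] vE] := v_scheme_spec HP h0 e0.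
rewrite -subr_le0 -[X in _ <= X](mul0r (1 - q)^-1).
apply: (contraction_ub (z := fun x => vh x - S pi x) (gamma_range HP h0)).
  exists (M' + M) => y; apply: lerD; first exact: le_trans (ler_norm _) (vM y).
  by have /ler_normlP[] := SM y.
move=> K SK y; rewrite addr0 {1}SE {1}vE.
have nb z : vh z <= S pi z + K by have := SK z; lra.
have := bell_le HP eps (x := y) h0 (pp.2 y) (fun i => nb _) (fun i => nb _).
by have := bellF_le HP eps vh y h0 (pp.2 y); lra.
Qed.

Context (pibar : V -> W) (Hbar : policy P pibar).
Local Notation loc := (localized P pibar h L).
Local Notation vs := (v_star P pibar eps h L).

Lemma v_star_le pi x : loc pi -> vs x <= S pi x.
Proof.
move=> lpi; apply: ge_inf; last by exists pi.
by exists 0 => _ [sigma [sp _] <-]; exact: policy_value_ge0.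
Qed.

Lemma v_star_ge c x : (forall pi, loc pi -> c <= S pi x) -> c <= vs x.
Proof.
move=> cS; apply: lb_le_inf; first by exists (S pibar x), pibar.
by move=> _ [pi lpi <-]; exact: cS.
Qed.

Lemma v_scheme_le_v_star x : vh x <= vs x.
Proof. by apply: v_star_ge => pi [pp _]; exact: v_scheme_le_policy_value. Qed.

Lemma cube_closed r : closed (cube r : set V).
Proof.
rewrite (_ : cube r = \bigcap_i ((fun x : V => x 0 i) @^-1` `[- r, r])).
  apply: closed_bigI => i _; apply: closed_comp; last exact: itv_closed.
  by move=> x _; exact: coord_continuous.
by apply/seteqP; split => x xr i //=; rewrite ?in_itv/=; [move=> _|]; exact: xr.
Qed.

(** Measurable selection by first index: since [v] is the infimum of the Bellman maps, some [s n] is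
    strictly [e]-optimal at each point, and the least such [n] has Borel level sets. *)
Lemma greedy_localized (v : V -> R) e : 0 < e -> borel v ->
  (forall x, v x = bellF P eps h v x) ->
  exists pi, loc pi /\ forall x, cube (L - h) x -> bell (pi x) v x <= v x + e.
Proof.
move=> e1 mv vE.
have [s [As ds]] := compact_dense_seq (ctrls_compact HP) (ctrls_neq0 HP).
pose G n := [set x | bell (s n) v x < v x + e].
have mG n : measurable (G n : set (Borel V)).
  rewrite (_ : G n = [set x | bell (s n) v x + -1 * v x < e]).
    apply: borel_lt; apply: borelD; first exact: bell_borel.
    by apply: borelM => //; exact: borel_cst.
  by apply/seteqP; split => x; rewrite /G /= mulN1r; lra.
have exG x : exists n, `[< G n x >].
  have [|n Gn] := bellF_lt_dense HP (eps := eps) (v := v) (x := x)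
      (r := v x + e) h0 As ds.
    by rewrite -vE ltrDl.
  by exists n; apply/asboolP.
pose k x := ex_minn (exG x).
have kG x : G (k x) x by rewrite /k; case: ex_minnP => n /asboolP.
have kE n : [set x | k x = n] = G n `\` \bigcup_(i in `I_n) G i.
  apply/seteqP; split => x /=.
    move=> <-; split => // -[i ik Gi]; move: ik; rewrite /k.
    by case: ex_minnP => j _ /(_ i (asboolT Gi)) ji /=; rewrite ltnNge ji.
  move=> [Gn nG]; rewrite /k;
    case: ex_minnP => j /asboolP Gj /(_ n (asboolT Gn)) jn.
  apply/eqP; rewrite eqn_leq jn leqNgt; apply/negP => ji.
  by apply: nG; exists j.
have mk n : measurable ([set x | k x = n] : set (Borel V)).
  rewrite kE; apply: measurableD; first exact: mG.
  by apply: bigcup_measurable => i _; exact: mG.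
have mC : measurable (cube (L - h) : set (Borel V)).
  by apply: closed_borel; exact: cube_closed.
pose pi x := if `[< cube (L - h) x >] then s (k x) else pibar x.
exists pi; split; last first.
  by move=> x Cx; rewrite /pi asboolT// ltW//; exact: kG.
split; last by move=> x Cx; rewrite /pi asboolF.
split; last by move=> x; rewrite /pi; case: ifP => // _; exact: Hbar.2.
move=> _ Y mY; rewrite setTI.
rewrite (_ : _ @^-1` _ =
    (cube (L - h) `&` \bigcup_(n in [set n | Y (s n)]) [set x | k x = n])
    `|` (~` cube (L - h) `&` pibar @^-1` Y)).
  apply: measurableU; apply: measurableI => //.
  - by apply: bigcup_measurable => n _; exact: mk.
  - exact: measurableC.
  - by rewrite -[X in measurable X]setTI; apply: Hbar.1.
apply/seteqP; split => x /=; rewrite /pi.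
  by case: asboolP => Cx Yx; [left; split => //; exists (k x)|right].
by move=> [[Cx [n /= Yn kn]]|[Cx Yx]]; [rewrite asboolT// kn|rewrite asboolF].
Qed.

(** Outside the greedy region only the crude bound [vbound] is available. A comparison at a point
    involves only its neighbours, so each mesh layer crossed inwards gains a factor [gamma_h]. *)
Lemma v_star_le_v_scheme n x :
  cube (L - n%:R * h) x -> vs x <= vh x + q ^+ n * B.
Proof.
move=> Cx; apply/ler_addgt0Pr => e e1.
have [[_ mv] vE] := v_scheme_spec HP h0 e0.
(* The slack is paid once per layer, and [n] times [e / n.+1] is at most [e]. *)
have [|pi [lpi pig]] := greedy_localized (e := e / n.+1%:R) _ mv vE.
  by rewrite divr_gt0.
have [pp _] := lpi; have [_ SE] := policy_value_spec HP h0 e0 pp.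
have /andP[q0 q1] := gamma_range HP h0; set t := e / _ in pig.
have t0 : 0 < t by rewrite divr_gt0.
suff Sv j y : cube (L - j%:R * h) y -> S pi y <= vh y + q ^+ j * B + j%:R * t.
  apply: (le_trans (v_star_le x lpi)); apply: (le_trans (Sv n x Cx)).
  rewrite lerD2l /t mulrCA ler_piMr ?(ltW e1)// ler_pdivrMr// mul1r.
  by rewrite ler_nat.
elim: j y => [|j IHj] y Cy.
  rewrite expr0 mul1r mul0r addr0 (le_trans (policy_value_le _ pp))//.
  by rewrite lerDr v_scheme_ge0.
(* In this form [cube_basis] puts the neighbours in the cube of stage [j], and [cube_sub] puts [y]
   in the greedy region. *)
have Cj : cube (L - j%:R * h - h) y.
  by move: Cy; rewrite -natr1 mulrDl mul1r opprD addrA.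
have jh : 0 <= j%:R * h by rewrite mulr_ge0// ltW.
have Ch : cube (L - h) y by apply: cube_sub Cj; lra.
have nb1 i : S pi (y + h *: basis i)
    <= vh (y + h *: basis i) + (q ^+ j * B + j%:R * t).
  by rewrite addrA; apply: IHj; have [] := cube_basis i (ltW h0) Cj.
have nb2 i : S pi (y - h *: basis i)
    <= vh (y - h *: basis i) + (q ^+ j * B + j%:R * t).
  by rewrite addrA; apply: IHj; have [] := cube_basis i (ltW h0) Cj.
have := bell_le HP eps h0 (pp.2 y) nb1 nb2; rewrite -SE.
have := pig y Ch; rewrite exprS -natr1.
have : q * (j%:R * t) <= j%:R * t.
  by rewrite ler_piMl ?(ltW q1)// mulr_ge0// ltW.
by rewrite mulrDr; lra.
Qed.

(* The two halves of one step of approximate policy iteration: [S pi'] cannot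
   exceed [S pi] by more than [beta / (1 - q)], so one application of the
   Bellman map to [S pi] already controls [S pi']. *)
Lemma policy_improvement pi pi' (v : V -> R) xi g E : loc pi -> loc pi' ->
  0 <= xi -> 0 <= g ->
  (forall x, cube L x -> `|v x - S pi x| <= xi) ->
  (forall x, cube (L - h) x -> Gamma P eps h v pi' x <= g) ->
  (forall x, S pi x - vs x <= E) ->
  forall x, S pi' x - vs x
    <= q * E + (2 * q * xi + h / kappa P h * g) / (1 - q).
Proof.
move=> [pp lpi] [pp' lpi'] xi0 g0 vxi vg SE x; set beta := 2 * q * xi + _.
have /andP[q0 q1] := gamma_range HP h0; have k0 := hk_gt0 HP h0.
have beta0 : 0 <= beta.
  have := mulr_ge0 (ltW k0) g0; have := mulr_ge0 q0 xi0.
  by rewrite /beta -mulrA; lra.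
have [[[M SM] _] wE] := policy_value_spec HP h0 e0 pp.
have [[[M' SM'] _] wE'] := policy_value_spec HP h0 e0 pp'.
(* Off the inner cube both policies equal [pibar]. Inside it, exchanging [S pi] and [v] at the
   neighbours costs [q * xi] twice, and [Gamma] bounds the advantage of any control over [pi' y]. *)
have greedy sigma y : loc sigma ->
    bell (pi' y) (S pi) y <= bell (sigma y) (S pi) y + beta.
  move=> [ps lps]; have [Cy|Cy] := pselect (cube (L - h) y); last first.
    by rewrite lpi'// lps// lerDl.
  have Lle := L_op_le_F_op HP eps h v y (ps.2 y).
  have := vg y Cy; rewrite /Gamma => Gle.
  have {}Gle : h / kappa P h * (L_op P eps h (cst (sigma y)) v y
      - L_op P eps h (cst (pi' y)) v y) <= h / kappa P h * g.
    by rewrite ler_pM2l// (le_trans _ Gle)// lerD2r.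
  have nbd z : cube L z -> S pi z <= v z + xi /\ v z <= S pi z + xi.
    by move=> /vxi /ler_normlP[*]; split; lra.
  have nbc i := cube_basis i (ltW h0) Cy.
  have := bell_le HP eps h0 (pp'.2 y) (fun i => (nbd _ (nbc i).1).1)
    (fun i => (nbd _ (nbc i).2).1).
  have := bell_le HP eps h0 (ps.2 y) (fun i => (nbd _ (nbc i).1).2)
    (fun i => (nbd _ (nbc i).2).2).
  move: Gle; rewrite !(bell_L_opE HP eps _ v)// mulrBr /beta; lra.
have Spi' y : S pi' y <= S pi y + beta / (1 - q).
  rewrite -lerBlDl.
  apply: (contraction_ub (z := fun y => S pi' y - S pi y) (gamma_range HP h0)).
    exists (M' + M) => z; apply: lerD.
      exact: le_trans (ler_norm _) (SM' z).
    by have /ler_normlP[] := SM z.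
  move=> K SK z; rewrite {1}wE' [S pi z]wE.
  have nb z' : S pi' z' <= S pi z' + K by have := SK z'; lra.
  have := bell_le HP eps (x := z) h0 (pp'.2 z) (fun i => nb _) (fun i => nb _).
  by have := greedy pi z (conj pp lpi); lra.
rewrite lerBlDl; set K := beta / (1 - q) in Spi' *.
have KE : beta = K - q * K.
  by rewrite -[X in X - _]mul1r -mulrBl mulrC divfK// subr_eq0 gt_eqF.
(* For each [sigma]: passing from [S pi'] to [S pi] costs [q * K], changing the control costs
   [beta], passing to [S sigma] costs [q * E]; and [q * K + beta = K]. *)
rewrite -lerBlDr; apply: v_star_ge => sigma lsigma; have [ps _] := lsigma.
have [_ sE] := policy_value_spec HP h0 e0 ps.
have := bell_le HP eps (x := x) h0 (pp'.2 x) (fun i => Spi' _)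
  (fun i => Spi' _).
have nb y : S pi y <= S sigma y + E.
  by have := v_star_le y lsigma; have := SE y; lra.
have := bell_le HP eps (x := x) h0 (ps.2 x) (fun i => nb _) (fun i => nb _).
have := greedy sigma x lsigma; rewrite -wE' -sE; lra.
Qed.

Lemma policy_iteration (n : nat) (pi : nat -> V -> W) (v : nat -> V -> R)
    xi g E :
  0 <= xi -> 0 <= g ->
  (forall j, (j <= n)%N -> loc (pi j)) ->
  (forall j x, (j < n)%N -> cube L x -> `|v j x - S (pi j) x| <= xi) ->
  (forall j x, (j < n)%N -> cube (L - h) x ->
    Gamma P eps h (v j) (pi j.+1) x <= g) ->
  (forall x, S (pi 0%N) x - vs x <= E) ->
  forall x, S (pi n) x - vs x
    <= q ^+ n * E + (2 * q * xi + h / kappa P h * g) / (1 - q) ^+ 2.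
Proof.
move=> xi0 g0 lpi vxi vg SE; set beta := 2 * q * xi + _.
have /andP[q0 q1] := gamma_range HP h0; have k0 := hk_gt0 HP h0.
have beta0 : 0 <= beta.
  have := mulr_ge0 (ltW k0) g0; have := mulr_ge0 q0 xi0.
  by rewrite /beta -mulrA; lra.
(* [K] is the fixed point of the error recursion sending [c] to [q * c + beta / (1 - q)], hence the
   square. *)
pose K := beta / (1 - q) ^+ 2.
have KE : beta / (1 - q) = K - q * K.
  by rewrite /K; field; rewrite subr_eq0 gt_eqF.
have K0 : 0 <= K by rewrite divr_ge0// sqr_ge0.
suff Sj j : (j <= n)%N -> forall x, S (pi j) x - vs x <= q ^+ j * E + K.
  exact: Sj.
elim: j => [_ x|j IHj jn x]; first by rewrite expr0 mul1r ler_wpDr.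
have := policy_improvement (lpi j (ltnW jn)) (lpi _ jn) xi0 g0
  (fun y => vxi j y jn) (fun y => vg j y jn) (IHj (ltnW jn)) x.
by rewrite -/beta KE exprS; lra.
Qed.

End PolicyIteration.

(** * Extended-real limits and decay of the contraction factor *)

Section Limits.
Context {R : realType}.

Lemma cvg0_near_le (X : nat -> \bar R) (e : R) : X @ \oo --> 0%E -> 0 < e ->
  \forall k \near \oo, (X k <= e%:E)%E.
Proof.
move=> /fine_cvgP[Xf /cvgr_lt X0] e0.
near=> k; rewrite -(@fineK _ (X k)); last by near: k.
by rewrite lee_fin ltW//; near: k; exact: X0.
Unshelve. all: by end_near. Qed.

Lemma near_le_cvg0 (X : nat -> \bar R) : (forall k, 0 <= X k)%E ->
  (forall e, 0 < e -> \forall k \near \oo, (X k <= e%:E)%E) -> X @ \oo --> 0%E.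
Proof.
move=> X0 Xe.
have finX k e : (X k <= e%:E)%E -> X k \is a fin_num.
  by move=> Xke; rewrite ge0_fin_numE// (le_lt_trans Xke) ?ltry.
apply/fine_cvgP; split.
  by apply: filterS (Xe 1 ltr01) => k /finX.
apply/cvgrPdist_le => e e0; apply: filterS (Xe e e0) => k Xke.
rewrite sub0r normrN ger0_norm ?fine_ge0//.
by rewrite -lee_fin fineK// (finX _ _ Xke).
Qed.

Lemma supnorm_ub T (D : set T) (z : T -> \bar R) x : D x ->
  (`|z x| <= supnorm D z)%E.
Proof. by move=> Dx; apply: ereal_sup_ubound; right; exists x. Qed.

Lemma supnorm_le T (D : set T) (z : T -> \bar R) (e : \bar R) : (0 <= e)%E ->
  (forall x, D x -> (`|z x| <= e)%E) -> (supnorm D z <= e)%E.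
Proof.
by move=> e0 ze; apply: ge_ereal_sup => _ [->//|[x Dx <-]]; exact: ze.
Qed.

Lemma supnorm_ge0 T (D : set T) (z : T -> \bar R) : (0 <= supnorm D z)%E.
Proof. by apply: ereal_sup_ubound; left. Qed.

(** With [y = lambda h / (2dN)], [gamma_h = 1 / (1 + y) <= 1 - y / 2 <= exp (- y / 2)]. The first
    inequality is where [y <= 1] enters. *)
Lemma gamma_pow_le d m (P : model R d m) h n : standing P -> 0 < h ->
  lambda P * h <= 2 * d%:R * Nv P ->
  gamma_h P h ^+ n <= expR (- (n%:R * h * lambda P / (4 * d%:R * Nv P))).
Proof.
move=> HP h0 lh; have D0 := dimN_gt0 HP; have l0 := lambda_gt0 HP.
pose y := lambda P * h / (2 * d%:R * Nv P).
have y0 : 0 < y by rewrite divr_gt0// mulr_gt0.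
have y1 : y <= 1 by rewrite ler_pdivrMr// mul1r.
have -> : - (n%:R * h * lambda P / (4 * d%:R * Nv P)) = n%:R * - (y / 2).
  rewrite /y; field; move: D0; rewrite -mulrA pmulr_rgt0// => D0.
  by have := lt0r_neq0 D0; rewrite mulf_eq0 negb_or => /andP[-> ->].
rewrite expRM_natl lerXn2r ?nnegrE ?expR_ge0//.
  by case/andP: (gamma_range HP h0).
have -> : gamma_h P h = (1 + y)^-1.
  have -> : 1 + y = kappa P h / (2 * d%:R * Nv P).
    by rewrite /kappa [RHS]mulrDl divff ?gt_eqF// addrC.
  by rewrite invf_div.
have y10 : 0 < 1 + y by rewrite addr_gt0.
rewrite -[leLHS]mul1r ler_pdivrMr//.
apply: (@le_trans _ _ ((1 - y / 2) * (1 + y))); last first.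
  by rewrite ler_pM2r// expR_ge1Dx.
nra.
Qed.

End Limits.

(** * The L2 norm on bounded sets *)

Section L2.
Context {R : realType} {d : nat}.
Notation V := 'rV[R]_d.
Local Open Scope ereal_scope.

(** The cube, completed by empty sets, is an admissible cover, and it is a box of side [2 * r]. *)
Lemma lebesgue_outer_cube (r : R) : (0 <= r)%R ->
  @lebesgue_outer R d (cube r) <= ((2 * r) ^+ d)%:E.
Proof.
move=> r0; pose C n : set (Borel V) := if n is 0%N then cube r else set0.
have CE : cube r = box (const_mx (- r)%R) (const_mx r) :> set V.
  by apply/seteqP; split => x xr i; have := xr i; rewrite !mxE.
apply: (@le_trans _ _ (\sum_(k <oo) box_volume (C k))).
  apply: ereal_inf_lbound; exists C => //; split.
    case=> [|n]; last exact: measurable0.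
    by apply: closed_borel; exact: cube_closed.
  by move=> x xr; exists 0%N.
rewrite nneseries_recl//; last by move=> k _; exact: box_volume_ge0.
rewrite eseries0 ?adde0; last by case=> // k _ _; exact: box_volume0.
apply: ereal_inf_lbound; right.
exists (const_mx (- r)%R), (const_mx r); split => //.
  by move=> i; rewrite !mxE; lra.
congr EFin; rewrite (eq_bigr (fun=> 2 * r)%R) => [|i _]; last first.
  by rewrite !mxE; ring.
by rewrite prodr_const card_ord.
Qed.

Import HBNNSimple.

(* Neither [g] nor [E] need be measurable: the integral is a supremum over
   simple functions below [g], whose supports are measurable subsets of [E]. *)
Lemma integral_le_support d' (T : measurableType d')
    (mu : {measure set T -> \bar R}) (g : T -> \bar R) (E : set T) (c : R)
    (M : \bar R) :
  (0 <= c)%R -> (forall x, 0 <= g x <= c%:E) -> (forall x, ~ E x -> g x = 0) ->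
  (forall F, measurable F -> F `<=` E -> mu F <= M) ->
  \int[mu]_x g x <= c%:E * M.
Proof.
move=> c0 gc gE muM; rewrite ge0_integralTE; last first.
  by move=> x; have /andP[] := gc x.
apply: ge_ereal_sup => _ [h hg <-].
rewrite -integralT_nnsfun.
(* [h] is at most [c] times the indicator of [F], and [F] lies in [E] because [g] vanishes off
   [E]. *)
pose F := h @^-1` `]0%R, +oo[.
have mF : measurable F by rewrite -[F]setTI; exact: measurable_funP.
apply: (@le_trans _ _ (\int[mu]_x (c * \1_F x)%:E)).
  apply: ge0_le_integral => //.
  - by move=> x _; rewrite lee_fin.
  - exact/measurable_EFinP.
  - apply/measurable_EFinP; apply: measurable_funM.
      exact: measurable_cst.
    exact: measurable_indic.
  move=> x _; rewrite lee_fin indicE; have [hx|hx] := ltP 0%R (h x).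
    rewrite mem_set ?mulr1; last by rewrite /F /= in_itv/= andbT.
    by rewrite -lee_fin (le_trans (hg x))//; have /andP[] := gc x.
  by rewrite (le_trans hx)// mulr_ge0.
under eq_integral do rewrite EFinM.
rewrite ge0_integralZl//; last first.
  by apply/measurable_EFinP; exact: measurable_indic.
rewrite integral_indic// setIT lee_wpmul2l//.
apply: muM => // x; rewrite /F /= in_itv/= andbT => hx.
by apply: contrapT => /gE gx; have := hg x; rewrite gx lee_fin leNgt hx.
Qed.

Lemma L2norm_le (K : set V) (z : V -> \bar R) (r e : R) :
  (0 <= r)%R -> (0 <= e)%R ->
  K `<=` cube r -> (forall x, K x -> `|z x| <= e%:E) ->
  L2norm K z <= (e * Num.sqrt ((2 * r) ^+ d))%:E.
Proof.
move=> r0 e0 Kr Kz; have vol0 : (0 <= (2 * r) ^+ d)%R.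
  by rewrite exprn_ge0// mulr_ge0.
pose g x := `|(z \_ K) x| `^ 2.
have g0 x : 0 <= g x by exact: poweR_ge0.
have gK x : ~ K x -> g x = 0.
  by move=> Kx; rewrite /g patchE memNset// abse0 poweR0r.
have ge x : 0 <= g x <= (e ^+ 2)%:E.
  rewrite g0/=; have [Kx|/gK->] := pselect (K x).
  2: by rewrite lee_fin exprn_ge0.
  rewrite /g patchE mem_set//; have := Kz x Kx; case: (z x) => [s| |]//.
  rewrite abse_EFin lee_fin poweR_EFin lee_fin powR_mulrn// => se.
  by rewrite lerXn2r ?nnegrE.
have gI : \int[lebesgue_rV R d]_x g x <= (e ^+ 2 * (2 * r) ^+ d)%:E.
  rewrite (EFinM (e ^+ 2)).
  apply: (integral_le_support (mu := lebesgue_rV R d) (exprn_ge0 2 e0) ge gK).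
  move=> F _ FK; apply: le_trans (lebesgue_outer_cube r0).
  by apply: (le_outer_measure lebesgue_outer); exact: subset_trans FK Kr.
rewrite /L2norm unlock -/g.
apply: (@le_trans _ _ ((e ^+ 2 * (2 * r) ^+ d)%:E `^ 2^-1)).
  apply: gt0_ler_poweR => //; rewrite in_itv/= ?leey ?andbT ?integral_ge0//.
    by move=> x _; exact: poweR_ge0.
  by rewrite lee_fin mulr_ge0// exprn_ge0.
rewrite poweR_EFin powR12_sqrt; last by rewrite mulr_ge0// exprn_ge0.
by rewrite sqrtrM ?exprn_ge0// sqrtr_sqr ger0_norm.
Qed.

End L2.

(** * Error estimates at a fixed mesh *)

Section Convergence.
Context {R : realType} {d m : nat} (P : model R d m) (HP : standing P).
Notation V := 'rV[R]_d.
Notation W := 'rV[R]_m.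

(** The 2 collects the last evaluation error and the initial gap; the other terms come from
    [policy_iteration_error] and [localization_error]. *)
Definition err_const (delta : R) : R :=
  2 + (4 * (2 * d%:R * Nv P) ^+ 2 + 2 * (2 * d%:R * Nv P)) / lambda P ^+ 2
  + delta / (24 * Cext P) * ((fnorm P + Mp P) / lambda P).

Lemma err_const_gt0 delta : 0 < delta -> 0 < err_const delta.
Proof.
move=> d0; have := dimN_gt0 HP; set N2 := 2 * d%:R * Nv P => N0.
have l0 := lambda_gt0 HP; have C0 := Cext_gt0 HP; have f0 := fnorm_ge0 HP.
have M0 := Mp_gt0 HP.
rewrite /err_const -/N2 -addrA ltr_pwDl// addr_ge0//.
  by rewrite divr_ge0 ?exprn_ge0 ?(ltW l0)//; have := exprn_gt0 2 N0; lra.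
rewrite mulr_ge0//; first by rewrite divr_ge0 ?(ltW d0)// mulr_ge0 ?(ltW C0).
by rewrite divr_ge0 ?(ltW l0)// addr_ge0 ?(ltW M0).
Qed.

Context (pibar : V -> W) (Hbar : policy P pibar).
Context (eps h L : R) (h0 : 0 < h) (e0 : 0 < eps).
Context (heps : h <= eps) (lh : lambda P * h <= 2 * d%:R * Nv P).
Local Notation S := (policy_value P eps h).
Local Notation q := (gamma_h P h).
Local Notation vs := (v_star P pibar eps h L).
Local Notation vh := (v_scheme P eps h).
Local Notation N2 := (2 * d%:R * Nv P).

(** The weights [h ^+ 2] on the evaluation error and [h] on the greedy residual exactly cancel
    [(1 - q) ^+ 2], which is of order [h ^+ 2]; then [kappa h <= 4dN]. *)
Lemma policy_iteration_error e : 0 <= e ->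
  (2 * q * (e * h ^+ 2) + h / kappa P h * (e * h)) / (1 - q) ^+ 2
    <= e * ((4 * N2 ^+ 2 + 2 * N2) / lambda P ^+ 2).
Proof.
move=> e1; have k0 := kappa_gt0 HP h0; have l0 := lambda_gt0 HP.
rewrite one_sub_gamma// gammaE.
have -> : (2 * (N2 / kappa P h) * (e * h ^+ 2) + h / kappa P h * (e * h))
    / (lambda P * h / kappa P h) ^+ 2
  = e * ((2 * N2 * kappa P h + kappa P h) / lambda P ^+ 2).
  by field; rewrite !gt_eqF.
have kN : kappa P h <= 2 * N2 by have := lh; rewrite /kappa; lra.
rewrite ler_wpM2l// ler_pM2r ?invr_gt0 ?exprn_gt0//.
have := dimN_gt0 HP; move: kN k0; set N := N2; set kk := kappa P h => *; nra.
Qed.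

Lemma localization_error (K : set V) delta D x : 0 < delta -> h <= 1 -> 0 < D ->
  4 * d%:R * Nv P / lambda P * ln (24 * Cext P / (delta * h ^+ 2)) <= D ->
  ((D + h)%:E < setdist K (~` cube L))%E -> K x ->
  vs x <= vh x + delta / (24 * Cext P) * ((fnorm P + Mp P) / lambda P) * h.
Proof.
move=> d0 h1 D0 HD KD Kx; have C0 := Cext_gt0 HP; have l0 := lambda_gt0 HP.
have N0 := dimN_gt0 HP; have f0 := fnorm_ge0 HP; have M0 := Mp_gt0 HP.
have hp := h0; have Dh : 0 <= D + h by lra.
have Cx := cube_setdist Dh KD Kx.
have Dh0 : 0 <= D / h by rewrite divr_ge0 ?ltW.
(* With [n] the integer part of [D / h], [n.+1] mesh steps exceed [D], as the decay estimate
   requires, yet fit into the available distance [D + h]. *)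
have /andP[] := truncn_itv Dh0; set n := Num.truncn _.
rewrite ler_pdivlMr// ltr_pdivrMr// => nD Dn.
have Cn : cube (L - n.+1%:R * h) x.
  by apply: cube_sub Cx; rewrite -natr1 mulrDl mul1r; lra.
apply: (le_trans (v_star_le_v_scheme HP h0 e0 Hbar Cn)); rewrite lerD2l.
pose X := 24 * Cext P / (delta * h ^+ 2).
have X0 : 0 < X by rewrite divr_gt0 ?mulr_gt0// exprn_gt0.
have qX : q ^+ n.+1 <= delta / (24 * Cext P) * h ^+ 2.
  have -> : delta / (24 * Cext P) * h ^+ 2 = expR (- ln X).
    rewrite expRN lnK ?posrE// /X invf_div; field.
    by rewrite gt_eqF.
  apply: (le_trans (gamma_pow_le _ HP h0 lh)); rewrite ler_expR lerN2.
  have N4 : 0 < 4 * d%:R * Nv P by lra.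
  rewrite ler_pdivlMr//.
  move: HD; rewrite -/X mulrAC ler_pdivrMr// mulrC => /le_trans; apply.
  by rewrite ler_pM2r// ltW.
apply: (le_trans (ler_wpM2r (vbound_ge0 HP e0) qX)).
set c := delta / _ in qX *.
have c0 : 0 <= c by rewrite divr_ge0 ?(ltW d0)// mulr_ge0 ?(ltW C0).
rewrite -[c * _ * h]mulrA -[c * _ * _]mulrA ler_wpM2l//.
rewrite /vbound mulrA [X in _ <= X]mulrAC ler_pM2r ?invr_gt0//.
(* The two parts of [vbound] are separated: [h ^+ 2 <= h] as [h <= 1], and [h ^+ 2 / eps <= h] as
   [h <= eps]. *)
rewrite mulrDr mulrDl lerD//.
  by rewrite mulrC ler_wpM2l// expr2 ler_piMl// ltW.
by rewrite mulrCA ler_pM2l// ler_pdivrMr// expr2 ler_pM2l.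
Qed.

(** From above, the chain runs through [S (pi n)] and [vs] to [vh]. From below,
    [vh <= vs <= S (pi n)], so only the evaluation error remains. *)
Lemma scheme_error (K : set V) delta D n (pi : nat -> V -> W)
    (v : nat -> V -> R) e x :
  0 < delta -> h <= 1 -> h <= e -> 0 < D ->
  4 * d%:R * Nv P / lambda P * ln (24 * Cext P / (delta * h ^+ 2)) <= D ->
  ((D + h)%:E < setdist K (~` cube L))%E -> K x ->
  (forall j, (j <= n)%N -> localized P pibar h L (pi j)) ->
  (forall j x, (j <= n)%N -> cube L x -> `|v j x - S (pi j) x| <= e * h ^+ 2) ->
  (forall j x, (j < n)%N -> cube (L - h) x ->
    Gamma P eps h (v j) (pi j.+1) x <= e * h) ->
  (forall x, q ^+ n * `|S (pi 0%N) x - vs x| <= e) ->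
  `|v n x - vh x| <= e * err_const delta.
Proof.
move=> d0 h1 he D0 HD KD Kx lpi vxi vg SE.
have hp := h0; have e1 : 0 < e by lra.
have Dh : 0 <= D + h by lra.
(* Positivity allows dividing: the initial gap enters [policy_iteration] as [e / q ^+ n] and comes
   out as [e]. *)
have q0 : 0 < q ^+ n.
  by rewrite exprn_gt0// gammaE divr_gt0 ?(dimN_gt0 HP) ?(kappa_gt0 HP).
have SE' y : S (pi 0%N) y - vs y <= e / q ^+ n.
  by rewrite ler_pdivlMr// mulrC (le_trans _ (SE y))// ler_pM2l// ler_norm.
have Cx : cube L x by apply: cube_sub (cube_setdist Dh KD Kx); lra.
have h2 : h ^+ 2 <= 1 by rewrite exprn_ile1// ltW.
have eh0 := ltW (mulr_gt0 e1 hp).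
have eh20 := ltW (mulr_gt0 e1 (exprn_gt0 2 hp)).
have := policy_iteration HP h0 e0 Hbar eh20 eh0 lpi
  (fun j y jn => vxi j y (ltnW jn)) vg SE' x.
rewrite mulrCA divff ?gt_eqF// mulr1.
have := policy_iteration_error (ltW e1).
have := localization_error d0 h1 D0 HD KD Kx.
have := v_star_le HP h0 e0 x (lpi n (leqnn n)).
have := v_scheme_le_v_star HP L h0 e0 Hbar x.
have /ler_normlP[] := vxi n x (leqnn n) Cx.
have : e * h ^+ 2 <= e by rewrite ler_piMr// ltW.
rewrite /err_const; set c1 := _ / lambda P ^+ 2; set c2 := delta / _ * _.
have c20 : 0 <= c2.
  rewrite mulr_ge0//.
    by rewrite divr_ge0 ?(ltW d0)// mulr_ge0 ?(ltW (Cext_gt0 HP)).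
  rewrite divr_ge0 ?(ltW (lambda_gt0 HP))// addr_ge0 ?(fnorm_ge0 HP)//.
  exact: ltW (Mp_gt0 HP).
have : c2 * h <= c2 * e by rewrite ler_wpM2l.
have c10 : 0 <= c1.
  have := dimN_gt0 HP; have := exprn_gt0 2 (lambda_gt0 HP); rewrite /c1.
  set N := N2 => l2 N0; rewrite divr_ge0 ?(ltW l2)//.
  by have := exprn_gt0 2 N0; lra.
have := mulr_ge0 (ltW e1) c10.
by move=> *; apply/ler_normlP; split; lra.
Qed.

End Convergence.

(** * Passage to the limit *)

Lemma abse_sub_le (R : realType) (a b : \bar R) (c s e1 e2 e3 : R) :
  (`|a - b| <= e1%:E)%E -> (`|b - c%:E| <= e2%:E)%E -> `|c - s| <= e3 ->
  (`|a - s%:E| <= (e1 + e2 + e3)%:E)%E.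
Proof.
(* Infinite cases contradict the finite bounds: an infinite [b] makes [b - c] infinite, and an
   infinite [a] with [b] finite makes [a - b] infinite. *)
case: a b => [a| |] [b| |]//; rewrite -!EFinB !abse_EFin !lee_fin => ab bc cs.
have -> : a - s = (a - b) + (b - c) + (c - s) by ring.
apply: le_trans (ler_normD _ _) _; apply: lerD => //.
by apply: le_trans (ler_normD _ _) _; exact: lerD.
Qed.

Lemma mule_sup_supnorm_le (R : realType) T I (c e : R) (J : set I) (D : set T)
    (z : I -> T -> R) j x : 0 < c ->
  (c%:E * ereal_sup [set supnorm D (fun x => (z j x)%:E) | j in J] <= e%:E)%E ->
  J j -> D x -> `|z j x| <= e / c.
Proof.
move=> c0 cE Jj Dx.
rewrite ler_pdivlMr// mulrC -lee_fin EFinM (le_trans _ cE)//.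
rewrite lee_pmul2l ?lte_fin// -abse_EFin.
apply: (le_trans (supnorm_ub (fun x => (z j x)%:E) Dx)).
by apply: ereal_sup_ubound; exists j.
Qed.

Lemma mule_sup_sup_le (R : realType) T I (c e : R) (J : set I) (D : set T)
    (z : I -> T -> R) j x : 0 < c ->
  (c%:E * ereal_sup [set ereal_sup [set (z j x)%:E | x in D] | j in J]
    <= e%:E)%E ->
  J j -> D x -> z j x <= e / c.
Proof.
move=> c0 cE Jj Dx.
rewrite ler_pdivlMr// mulrC -lee_fin EFinM (le_trans _ cE)//.
rewrite lee_pmul2l ?lte_fin//;
  apply: (@le_trans _ _ (ereal_sup [set (z j x)%:E | x in D])).
  by apply: ereal_sup_ubound; exists x.
by apply: ereal_sup_ubound; exists j.
Qed.

(** Both values lie between 0 and [vbound], which is of order [1 / eps]; this yields the sufficient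
    condition for (R3). *)
Lemma initial_gap_le (R : realType) (d m : nat) (P : model R d m)
    (HP : standing P) pibar (eps h L : R) pi x :
  0 < h -> 0 < eps -> policy P pibar -> localized P pibar h L pi ->
  `|policy_value P eps h pi x - v_star P pibar eps h L x| <= vbound P eps.
Proof.
move=> h0 e0 Hbar lpi; have [pp _] := lpi.
have := policy_value_le HP h0 e0 x pp.
have := v_star_le HP h0 e0 x lpi.
have := le_trans (v_scheme_ge0 HP h0 e0 x)
  (v_scheme_le_v_star HP L h0 e0 Hbar x).
by move=> *; apply/ler_normlP; split; lra.
Qed.

Theorem corollary6p10 (R : realType) (d m : nat) (P : model R d m)
  (HP : standing P)
  (r1 nu0 COmega : R) (dt : 'rV[R]_d -> R) (pibar : 'rV[R]_d -> 'rV[R]_m)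
  (Hin : inward_feedback P r1 nu0 COmega dt pibar)
  (Cstar h0 : R) (Hleak : leakage P pibar Cstar h0)
  (K : set 'rV[R]_d) (HK : compact K) (HKO : K `<=` closure (Omega P))
  (delta : R) (Hdelta : 0 < delta <= Mp P)
  (eps h L : nat -> R) (n : nat -> nat)
  (Heps : forall k, 0 < eps k) (Heps_dec : nonincreasing_seq eps)
  (Heps0 : eps @ \oo --> (0 : R))
  (Hh : forall k, 0 < h k < L k) (Hh_dec : nonincreasing_seq h)
  (Hh0 : h @ \oo --> (0 : R))
  (HL : L @ \oo --> +oo)
  (HOL : forall k, closure (Omega P) `<=` interior (cube (L k)))
  (Hn : n @ \oo --> \oo)
  (pol : nat -> nat -> 'rV[R]_d -> 'rV[R]_m)
  (Hpi : forall k j, (j <= n k)%N -> localized P pibar (h k) (L k) (pol k j))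
  (v : nat -> nat -> 'rV[R]_d -> R)
  (Hv : forall k j, (j <= n k)%N -> bounded_borel (v k j))
  (D : nat -> R)
  (HD : \forall k \near \oo, [/\ 0 < D k,
     [set y | cube (L k) y /\ dist y (~` cube (L k)) <= D k + h k] `<=`
       [set y | delta <= dist y (closure (Omega P))] &
     ((D k + h k)%:E < setdist K (~` cube (L k)))%E]) :
  let w k j := policy_value P (eps k) (h k) (pol k j) in
  let vs k := v_star P pibar (eps k) (h k) (L k) in
  let xi k j := supnorm (cube (L k)) (fun x => (v k j x - w k j x)%:E) in
  let R1 := forall k, h k <= Num.min h0 (eps k) /\
                      lambda P * h k <= 2 * d%:R * Nv P in
  let R2 := \forall k \near \oo,
    4 * d%:R * Nv P / lambda P * ln (24 * Cext P / (delta * h k ^+ 2)) <= D k in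
  let R3 := ((gamma_h P (h k) ^+ n k)%:E *
      supnorm setT (fun x => (w k 0%N x - vs k x)%:E))%E @[k --> \oo] --> 0%E in
  let R4 :=
    (((h k ^- 2)%:E * ereal_sup [set xi k j | j in [set j | (j <= n k)%N]])%E
       @[k --> \oo] --> 0%E) /\
    (((h k)^-1%:E * ereal_sup [set ereal_sup
         [set (Gamma P (eps k) (h k) (v k j) (pol k j.+1) x)%:E
            | x in cube (L k - h k)] | j in [set j | (j < n k)%N]])%E
       @[k --> \oo] --> 0%E) in
  let R5 :=
    (supnorm K (fun x => u_constrained P x - u_penalized P (eps k) x)%E
       @[k --> \oo] --> 0%E) /\
    (supnorm K (fun x => u_penalized P (eps k) x
                         - (v_scheme P (eps k) (h k) x)%:E)%E
       @[k --> \oo] --> 0%E) in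
  let err k := (fun x => u_constrained P x - (v k (n k) x)%:E)%E in
  (R1 -> R2 -> R3 -> R4 -> R5 ->
     (supnorm K (err k) @[k --> \oo] --> 0%E) /\
     (L2norm K (err k) @[k --> \oo] --> 0%E)) /\
  ((gamma_h P (h k) ^+ n k / eps k @[k --> \oo] --> (0 : R)) -> R3).
Proof.
have Hbar := pibar_policy Hin; have l0 := lambda_gt0 HP.
move=> w vs xi R1 R2 R3 R4 R5 err.
have hk0 k : 0 < h k by have /andP[] := Hh k.
have gam0 k : 0 < gamma_h P (h k) ^+ n k.
  by rewrite exprn_gt0// gammaE divr_gt0 ?(dimN_gt0 HP) ?(kappa_gt0 HP).
split; last first.
  move=> ge0; rewrite /R3; apply: near_le_cvg0 => [k|e e0].
    by rewrite mule_ge0 ?lee_fin ?(ltW (gam0 k))// supnorm_ge0.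
  (* Pulling [1 / eps k] out of [vbound] leaves a factor that is largest at [k = 0], because [eps]
     decreases. *)
  pose C := (fnorm P * eps 0%N + Mp P) / lambda P.
  have C0 : 0 < C.
    rewrite divr_gt0// ltr_wpDl ?(Mp_gt0 HP)// mulr_ge0 ?(fnorm_ge0 HP)//.
    exact: ltW (Heps _).
  have /(cvgr_lt _) := ge0 => /(_ (e / C)); rewrite divr_gt0// => /(_ isT).
  apply: filterS => k gk.
  have gB : gamma_h P (h k) ^+ n k * vbound P (eps k) <= e.
    have -> : gamma_h P (h k) ^+ n k * vbound P (eps k)
        = gamma_h P (h k) ^+ n k / eps k
          * ((fnorm P * eps k + Mp P) / lambda P).
      by rewrite /vbound; field; rewrite !gt_eqF.
    have Ck : (fnorm P * eps k + Mp P) / lambda P <= C.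
      rewrite /C ler_pM2r ?invr_gt0// lerD2r ler_wpM2l ?(fnorm_ge0 HP)//.
      exact: Heps_dec.
    apply: (le_trans (ler_wpM2l _ Ck)); first by rewrite ltW// divr_gt0.
    by rewrite -ler_pdivlMr// ltW.
  apply: (@le_trans _ _ (gamma_h P (h k) ^+ n k * vbound P (eps k))%:E) => //.
  rewrite EFinM lee_pmul2l ?lte_fin//; apply: supnorm_le.
    by rewrite lee_fin (vbound_ge0 HP).
  move=> x _; rewrite abse_EFin lee_fin.
  by apply: initial_gap_le => //; exact: Hpi.
move=> r1H r2H r3H [r4a r4b] [r5a r5b].
have /andP[d0 _] := Hdelta.
have CC0 := err_const_gt0 HP d0; pose C := 2 + err_const P delta.
have C0 : 0 < C by rewrite /C; lra.
(* A single pointwise bound, uniform on [K], serves both norms. The 2 in [C] accounts for the two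
   limits of (R5). *)
have errK e : 0 < e ->
    \forall k \near \oo, forall x, K x -> (`|err k x| <= e%:E)%E.
  move=> e0; pose t := e / C; have t0 : 0 < t by rewrite divr_gt0.
  have n3 := cvg0_near_le r3H t0; have n4a := cvg0_near_le r4a t0.
  have n4b := cvg0_near_le r4b t0; have n5a := cvg0_near_le r5a t0.
  have n5b := cvg0_near_le r5b t0.
  have nh1 : \forall k \near \oo, h k < 1 by exact: cvgr_lt Hh0 _ ltr01.
  have nht : \forall k \near \oo, h k < t by exact: cvgr_lt Hh0 _ t0.
  near=> k => x Kx.
  have [Dk _ DK] : [/\ 0 < D k,
     [set y | cube (L k) y /\ dist y (~` cube (L k)) <= D k + h k] `<=`
       [set y | delta <= dist y (closure (Omega P))] &
     ((D k + h k)%:E < setdist K (~` cube (L k)))%E] by near: k.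
  have /(le_trans (supnorm_ub _ Kx)) uu :
      (supnorm K (fun x => u_constrained P x - u_penalized P (eps k) x)
        <= t%:E)%E.
    by near: k.
  have /(le_trans (supnorm_ub _ Kx)) uv :
      (supnorm K (fun x => u_penalized P (eps k) x
                           - (v_scheme P (eps k) (h k) x)%:E) <= t%:E)%E.
    by near: k.
  have [hmin lh] := r1H k; move: hmin; rewrite le_min => /andP[_ heps].
  have vv : `|v_scheme P (eps k) (h k) x - v k (n k) x|
      <= t * err_const P delta.
    rewrite distrC.
    apply: (scheme_error HP Hbar (hk0 k) (Heps k) heps lh d0 _ _ Dk _ DK Kx
      (Hpi k)).
    - by apply: ltW; near: k.
    - by apply: ltW; near: k.
    - by near: k.
    (* The double inverse matches the quotient [e / c] with [c] the weight [h k ^- 2] of (R4). *)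
    - move=> j y jn Cy; rewrite -[h k ^+ 2]invrK.
      have c0 : 0 < h k ^- 2 by rewrite invr_gt0 exprn_gt0.
      have r4k : ((h k ^- 2)%:E *
        ereal_sup [set xi k j | j in [set j | (j <= n k)%N]] <= t%:E)%E.
        by near: k.
      exact: (mule_sup_supnorm_le (z := fun j x => v k j x - w k j x)
        c0 r4k jn Cy).
    - move=> j y jn Cy; rewrite -[X in _ <= _ * X]invrK.
      have c0 : 0 < (h k)^-1 by rewrite invr_gt0.
      have r4k : ((h k)^-1%:E * ereal_sup [set ereal_sup
         [set (Gamma P (eps k) (h k) (v k j) (pol k j.+1) x)%:E
            | x in cube (L k - h k)] | j in [set j | (j < n k)%N]] <= t%:E)%E.
        by near: k.
      exact: (mule_sup_sup_le
        (z := fun j x => Gamma P (eps k) (h k) (v k j) (pol k j.+1) x)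
        c0 r4k jn Cy).
    - move=> y.
      have r3k : ((gamma_h P (h k) ^+ n k)%:E *
        supnorm setT (fun x => (w k 0%N x - vs k x)%:E) <= t%:E)%E by near: k.
      rewrite -lee_fin EFinM (le_trans _ r3k)//.
      rewrite lee_pmul2l ?lte_fin// -abse_EFin.
      exact: (supnorm_ub (fun x => (w k 0%N x - vs k x)%:E)).
  have := abse_sub_le uu uv vv; rewrite -mulr2n -mulr_natl => /le_trans; apply.
  by rewrite lee_fin [2 * t]mulrC -mulrDr /t -/C divfK// gt_eqF.
split.
  apply: near_le_cvg0 => [k|e e0]; first exact: supnorm_ge0.
  apply: filterS (errK e e0) => k errk.
  by apply: supnorm_le; rewrite ?lee_fin ?ltW.
(* The cube of index 0 contains [K] and does not move with [k], so its volume gives a uniform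
   constant for the L2 bound. *)
have L0 : 0 <= L 0%N.
  by have /andP[_ ?] := Hh 0%N; rewrite ltW// (lt_trans (hk0 0%N)).
have KL : K `<=` cube (L 0%N).
  by move=> x /HKO /(HOL 0%N) /interior_subset.
pose s := Num.sqrt ((2 * L 0%N) ^+ d); have s0 : 0 <= s := sqrtr_ge0 _.
apply: near_le_cvg0 => [k|e e0]; first exact: Lnorm_ge0.
have s1 : 0 < s + 1 by lra.
apply: filterS (errK (e / (s + 1)) (divr_gt0 e0 s1)) => k errk.
apply: (le_trans (L2norm_le L0 (ltW (divr_gt0 e0 s1)) KL errk)).
by rewrite lee_fin -/s mulrAC ler_pdivrMr// ler_pM2l//; lra.
Unshelve. all: by end_near. Qed.
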